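(* Let $(\xi_y)_{y\in\mathbb{N}^2}$ be i.i.d. random variables with $P(\xi_y=k)=(1-\lambda)\lambda^k$ for $k=0,1,2,\dots$, where $\lambda\in(0,1)$, and fix $\beta>0$. For $N,M\in\mathbb{N}$ let $$G(N,M)=\max\sum_{j=1}^{N+M-1}\xi_{y_j},$$ the maximum being over all paths $(y_1,\dots,y_{N+M-1})$ in $\{1,\dots,N\}\times\{1,\dots,M\}$ with $y_1=(1,1)$, $y_{N+M-1}=(N,M)$ and $y_{j+1}-y_j\in\{(1,0),(0,1)\}$. Then almost surely $$\lim_{N\to\infty}\frac1N G(N,\lfloor\beta N\rfloor)=\frac{(1+\sqrt{\beta\lambda})^2}{1-\lambda}-1.$$ Moreover, for each $\delta>0$ there exist constants $C,c>0$ such that for all $N\in\mathbb{N}$ with $\lfloor\beta N\rfloor\ge1$, $$P\Bigl\{\Bigl|\frac1N G(N,\lfloor\beta N\rfloor)-\Bigl(\frac{(1+\sqrt{\beta\lambda})^2}{1-\lambda}-1\Bigr)\Bigr|>\delta\Bigr\}\le Ce^{-cN}.$$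
   Context: $\mathbb{N}=\{1,2,\dots\}$. *)

(* Defs.v *)
From HB Require Import structures.
From mathcomp Require Import all_boot all_order all_algebra.
From mathcomp Require Import all_classical all_reals all_analysis.
Set Implicit Arguments. Unset Strict Implicit. Unset Printing Implicit Defensive.
Import Order.TTheory GRing.Theory Num.Theory.
Local Open Scope classical_set_scope.
Local Open Scope ring_scope.

Definition site (y : nat * nat) : bool := (0 < y.1)%N && (0 < y.2)%N.

(* Mutual independence of the family (X y)_{y in N^2} of nat-valued random
   variables: product rule over every finite set of distinct sites and every
   choice of (measurable = arbitrary, nat being discrete) events. *)
Definition iid_indep d (T : measurableType d) (R : realType)
  (P : probability T R) (X : nat * nat -> T -> nat) : Prop :=
  forall (s : seq (nat * nat)) (B : nat * nat -> set nat),
    uniq s -> all site s ->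
    P [set w | forall y, y \in s -> B y (X y w)]
    = (\prod_(y <- s) P (X y @^-1` B y))%E.

Definition geometric_law d (T : measurableType d) (R : realType)
  (P : probability T R) (lambda : R) (X : T -> nat) : Prop :=
  forall k : nat, P (X @^-1` [set k]) = ((1 - lambda) * lambda ^+ k)%:E.

(* A path (y_1,...,y_{N+M-1}) is encoded as f : 'I_(N+M-1) -> 'I_N * 'I_M,
   with y_{j+1} = ((f j).1 + 1, (f j).2 + 1) in {1..N} x {1..M}. *)
Definition path_pt N M (f : {ffun 'I_(N + M - 1) -> 'I_N * 'I_M})
  (j : 'I_(N + M - 1)) : nat * nat :=
  (((f j).1 : nat).+1, ((f j).2 : nat).+1).

Definition up_right_step (y z : nat * nat) : bool :=
  ((z.1 == y.1.+1) && (z.2 == y.2)) || ((z.1 == y.1) && (z.2 == y.2.+1)).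

Definition is_up_right_path N M (f : {ffun 'I_(N + M - 1) -> 'I_N * 'I_M}) :
  bool :=
  [&& [forall j : 'I_(N + M - 1), (j == 0 :> nat) ==> (path_pt f j == (1, 1)%N)],
      [forall j : 'I_(N + M - 1), (j == (N + M - 2)%N :> nat) ==>
                                   (path_pt f j == (N, M))] &
      [forall j : 'I_(N + M - 1), forall k : 'I_(N + M - 1),
          (k == j.+1 :> nat) ==> up_right_step (path_pt f j) (path_pt f k)]].

Definition last_passage T (xi : nat * nat -> T -> nat) (N M : nat) (w : T) : nat :=
  \big[maxn/0%N]_(f : {ffun 'I_(N + M - 1) -> 'I_N * 'I_M} | is_up_right_path f)
     \sum_(j < N + M - 1) xi (path_pt f j) w.

(* Main.v *)
Require Import Defs.
From HB Require Import structures.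
From mathcomp Require Import all_boot all_order all_algebra.
From mathcomp Require Import all_classical all_reals all_analysis.
From mathcomp Require Import zify ring lra.
Set Implicit Arguments. Unset Strict Implicit. Unset Printing Implicit Defensive.
Import Order.TTheory GRing.Theory Num.Theory.
Import numFieldNormedType.Exports.

(** Everything is reduced to Chernoff bounds for sums of i.i.d. geometric
    variables by comparison with the stationary model: add weights of parameter
    [a] on the horizontal axis and [b] on the vertical axis, with [a * b = lambda].
    The corner flip [(I, J, w) |-> (w + (I - J)^+, w + (J - I)^+, min (I, J))]
    is an involution of [nat^3] preserving the product of geometric laws of
    parameters [a], [b], [a * b].  Sweeping the flips over the grid turns the
    vertical boundary weights into the increments of the passage time along the
    last column, which are therefore i.i.d. geometric of parameter [b].

    Upper tail: the passage time is at most that of the stationary model, which is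
    the sum of the horizontal boundary weights and of the last column increments;
    optimise over [a].  Lower tail: at the optimal [a] the stationary passage time
    has the right size; a path which follows the boundary for more than [eps * N]
    steps is too short, as seen from the upper tail bound with a slightly
    different parameter, while less than [eps * N] boundary steps contribute
    little, so the passage time in the bulk is almost as large. *)

Local Open Scope nat_scope.

(** * Last-passage recursion *)

(** Coordinates start at 0, so [lpp v n m] is the passage time over an n+1 by m+1 rectangle. The
    inner [fix] keeps the recursion structural in each coordinate. *)
Fixpoint lpp (v : nat -> nat -> nat) (i : nat) : nat -> nat :=
  fix row j := v i j +
    match i, j with
    | 0, 0 => 0
    | 0, j'.+1 => row j'
    | i'.+1, 0 => lpp v i' 0
    | i'.+1, j'.+1 => maxn (lpp v i' j'.+1) (row j')
    end.

Lemma lpp00 v : lpp v 0 0 = v 0 0. Proof. by rewrite /= addn0. Qed.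
Lemma lpp0S v j : lpp v 0 j.+1 = v 0 j.+1 + lpp v 0 j. Proof. by []. Qed.
Lemma lppS0 v i : lpp v i.+1 0 = v i.+1 0 + lpp v i 0. Proof. by []. Qed.
Lemma lppSS v i j :
  lpp v i.+1 j.+1 = v i.+1 j.+1 + maxn (lpp v i j.+1) (lpp v i.+1 j).
Proof. by []. Qed.
Definition lppE := (lpp00, lpp0S, lppS0, lppSS).
Arguments lpp : simpl never.

Lemma lpp_ext u v n m :
  (forall i j, i <= n -> j <= m -> u i j = v i j) -> lpp u n m = lpp v n m.
Proof.
elim: n m => [|n IHn]; elim=> [|m IHm] uv; rewrite !lppE ?uv//.
- by rewrite IHm// => i j ? ?; apply: uv; lia.
- by rewrite IHn// => i j ? ?; apply: uv; lia.
- by rewrite IHn ?IHm// => i j ? ?; apply: uv; lia.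
Qed.

Lemma lpp_transpose v n m : lpp (fun i j => v j i) n m = lpp v m n.
Proof.
by elim: n m => [|n IHn]; elim=> [|m IHm]; rewrite !lppE ?IHn ?IHm// maxnC.
Qed.

Lemma lpp_stepl v i j : lpp v i j + v i.+1 j <= lpp v i.+1 j.
Proof. by case: j => [|j]; rewrite !lppE; lia. Qed.

Lemma lpp_stepr v i j : lpp v i j + v i j.+1 <= lpp v i j.+1.
Proof. by case: i => [|i]; rewrite !lppE; lia. Qed.

Lemma lpp_ge v i j : v i j <= lpp v i j.
Proof. by case: i j => [|i] [|j]; rewrite !lppE; lia. Qed.

(** A path from (k, l) can be prolonged back to the origin, and the weights gained are natural
    numbers. *)
Lemma lpp_shift v k l n m :
  lpp (fun i j => v (i + k) (j + l)) n m <= lpp v (n + k) (m + l).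
Proof.
elim: n m => [|n IHn]; elim=> [|m IHm].
- by rewrite lppE !add0n; exact: lpp_ge.
- rewrite lppE !(add0n, addSn); rewrite add0n in IHm.
  by have := lpp_stepr v k (m + l); lia.
- rewrite lppE !(add0n, addSn); have := IHn 0; rewrite add0n.
  by have := lpp_stepl v (n + k) l; lia.
- rewrite [leqLHS]lppE; move: (IHn m.+1) IHm; rewrite !addSn.
  by have := lpp_stepl v (n + k) (m + l).+1;
     have := lpp_stepr v (n + k).+1 (m + l); lia.
Qed.

(* The corner weight of the stationary model is not counted. *)
Definition unpin (v : nat -> nat -> nat) i j :=
  if (i == 0) && (j == 0) then 0 else v i j.

Lemma lpp_unpinl v n : lpp (unpin v) n 0 = \sum_(1 <= i < n.+1) v i 0.
Proof.
elim: n => [|n IHn]; first by rewrite lppE big_geq.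
by rewrite lppE IHn [RHS]big_nat_recr//= addnC.
Qed.

Lemma lpp_unpinr v n : lpp (unpin v) 0 n = \sum_(1 <= i < n.+1) v 0 i.
Proof.
elim: n => [|n IHn]; first by rewrite lppE big_geq.
by rewrite lppE IHn [RHS]big_nat_recr//= addnC.
Qed.

(** A maximising path runs along one axis for [k.+1] sites and then enters the bulk for good. The
    lower tail takes a union bound over these exits. *)
Lemma lpp_exit v n m :
  (exists2 k, k <= n & lpp (unpin v) n.+1 m.+1 <=
     \sum_(1 <= i < k.+2) v i 0 + lpp (fun i j => v (i + k.+1) (j + 1)) (n - k) m)
  \/ (exists2 k, k <= m & lpp (unpin v) n.+1 m.+1 <=
     \sum_(1 <= j < k.+2) v 0 j + lpp (fun i j => v (i + 1) (j + k.+1)) n (m - k)).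
Proof.
(* Writing n = r + k keeps truncated subtraction out of the induction. *)
suff H :
    forall n m, (exists k r, n = r + k /\ lpp (unpin v) n.+1 m.+1 <=
       \sum_(1 <= i < k.+2) v i 0 + lpp (fun i j => v (i + k.+1) (j + 1)) r m)
    \/ (exists k r, m = r + k /\ lpp (unpin v) n.+1 m.+1 <=
       \sum_(1 <= j < k.+2) v 0 j + lpp (fun i j => v (i + 1) (j + k.+1)) n r).
  by case: (H n m) => [[k [r [-> le]]]|[k [r [-> le]]]]; [left|right]; exists k;
     rewrite ?addnK// leq_addl.
move=> {n m}; elim=> [|n IHn]; elim=> [|m IHm].
- have := lppSS (unpin v) 0 0; rewrite lpp_unpinl lpp_unpinr !big_nat1 {2}/unpin /=.
  by case: (leqP (v 0 1) (v 1 0)) => h E; [left|right]; exists 0, 0;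
    rewrite big_nat1 lpp00 !add0n; split=> //; rewrite E; lia.
- have := lppSS (unpin v) 0 m.+1; rewrite lpp_unpinr {2}/unpin /=.
  (* Either the maximum comes from the axis and the exit is at its last site, or the exit of the
     shorter path is inherited. *)
  case: (leqP (lpp (unpin v) 1 m.+1) (\sum_(1 <= i < m.+3) v 0 i)) => h E.
    by right; exists m.+1, 0; rewrite lpp00 !add0n; split=> //; lia.
  case: IHm => [[k [r [e le]]]|[k [r [e le]]]].
    left; exists k, r; split=> //.
    have := lpp_stepr (fun i j => v (i + k.+1) (j + 1)) r m.
    have [er ek] : r = 0 /\ k = 0 by lia.
    by rewrite er ek add0n !addn1 in le *; lia.
  right; exists k, r.+1; split; first by lia.
  have := lpp_stepr (fun i j => v (i + 1) (j + k.+1)) 0 r.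
  by cbv beta; rewrite !add0n !addSn !addnS -e; lia.
- have := lppSS (unpin v) n.+1 0; rewrite lpp_unpinl {2}/unpin /=.
  case: (leqP (lpp (unpin v) n.+1 1) (\sum_(1 <= i < n.+3) v i 0)) => h E.
    by left; exists n.+1, 0; rewrite lpp00 !add0n; split=> //; lia.
  case: (IHn 0) => [[k [r [e le]]]|[k [r [e le]]]].
    left; exists k, r.+1; split; first by lia.
    have := lpp_stepl (fun i j => v (i + k.+1) (j + 1)) r 0.
    by cbv beta; rewrite !add0n !addSn !addnS -e; lia.
  right; exists k, r; split=> //.
  have := lpp_stepl (fun i j => v (i + 1) (j + k.+1)) n r.
  have [er ek] : r = 0 /\ k = 0 by lia.
  by rewrite er ek add0n !addn1 in le *; lia.
- have := lppSS (unpin v) n.+1 m.+1; rewrite {2}/unpin /=.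
  case: (leqP (lpp (unpin v) n.+2 m.+1) (lpp (unpin v) n.+1 m.+2)) => h E.
    case: (IHn m.+1) => [[k [r [e le]]]|[k [r [e le]]]].
      left; exists k, r.+1; split; first by lia.
      have := lpp_stepl (fun i j => v (i + k.+1) (j + 1)) r m.+1.
      by cbv beta; rewrite !addSn !addnS ?addn0 -e; lia.
    right; exists k, r; split=> //.
    have := lpp_stepl (fun i j => v (i + 1) (j + k.+1)) n r.
    by cbv beta; rewrite !addSn !addnS ?addn0 -e; lia.
  case: IHm => [[k [r [e le]]]|[k [r [e le]]]].
    left; exists k, r; split=> //.
    have := lpp_stepr (fun i j => v (i + k.+1) (j + 1)) r m.
    by cbv beta; rewrite !addSn !addnS ?addn0 -e; lia.
  right; exists k, r.+1; split; first by lia.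
  have := lpp_stepr (fun i j => v (i + 1) (j + k.+1)) n.+1 r.
  by cbv beta; rewrite !addSn !addnS ?addn0 -e; lia.
Qed.

Lemma lpp_inner v n m :
  lpp (fun i j => v (i + 1) (j + 1)) n m <= lpp (unpin v) n.+1 m.+1.
Proof.
have := lpp_shift (unpin v) 1 1 n m; rewrite !addn1.
by congr (_ <= _); apply: lpp_ext => i j _ _; rewrite /unpin !addn1.
Qed.

(** * Increments of the stationary passage time *)

Definition vert_inc v i j := lpp (unpin v) i j.+1 - lpp (unpin v) i j.
Definition horiz_inc v i j := lpp (unpin v) i.+1 j - lpp (unpin v) i j.

(** Follow the horizontal axis, then climb the last column. The subtraction in [vert_inc] is exact
    because [lpp] is nondecreasing along columns. *)
Lemma lpp_telescope v n m : lpp (unpin v) n m =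
  \sum_(1 <= i < n.+1) v i 0 + \sum_(0 <= j < m) vert_inc v n j.
Proof.
elim: m => [|m IHm]; first by rewrite lpp_unpinl [X in _ + X]big_geq// addn0.
rewrite [X in _ + X]big_nat_recr//= addnA -IHm /vert_inc.
by have := lpp_stepr (unpin v) n m; lia.
Qed.

Lemma vert_inc0 v j : vert_inc v 0 j = v 0 j.+1.
Proof. by rewrite /vert_inc lpp0S {1}/unpin /= addnK. Qed.

Lemma horiz_inc0 v i : horiz_inc v i 0 = v i.+1 0.
Proof. by rewrite /horiz_inc lppS0 {1}/unpin /= addnK. Qed.

(** Together with [horiz_incS] this is the corner flip, truncated subtraction being the positive
    part: the increments entering a cell and its weight determine the increments leaving it. *)
Lemma vert_incS v i j :
  vert_inc v i.+1 j = v i.+1 j.+1 + (vert_inc v i j - horiz_inc v i j).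
Proof.
rewrite /vert_inc /horiz_inc; have := lppSS (unpin v) i j; rewrite {2}/unpin /=.
by have := lpp_stepr (unpin v) i j; have := lpp_stepl (unpin v) i j; lia.
Qed.

Lemma horiz_incS v i j :
  horiz_inc v i j.+1 = v i.+1 j.+1 + (horiz_inc v i j - vert_inc v i j).
Proof.
rewrite /vert_inc /horiz_inc; have := lppSS (unpin v) i j; rewrite {2}/unpin /=.
by have := lpp_stepr (unpin v) i j; have := lpp_stepl (unpin v) i j; lia.
Qed.

(** * Up-right paths and the recursion *)

Lemma up_right_sum_le v K (f : 'I_K -> nat * nat) :
  (forall j : 'I_K, j = 0 :> nat -> f j = (0, 0)) ->
  (forall j k : 'I_K, k = j.+1 :> nat -> up_right_step (f j) (f k)) ->
  forall t : 'I_K,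
    \sum_(j < K | j <= t) v (f j).1 (f j).2 <= lpp v (f t).1 (f t).2.
Proof.
move=> f0 fS [t tK]; elim: t tK => [|t IH] tK /=.
  rewrite (big_pred1 (Ordinal tK)) ?f0// ?lpp00// => j.
  by rewrite leqn0; apply/eqP/eqP => [j0|->//]; exact: val_inj.
rewrite (bigD1 (Ordinal tK))//=.
have tK' : t < K by lia.
rewrite (eq_bigl (fun j : 'I_K => j <= t)); last first.
  by move=> j; rewrite -val_eqE /=; lia.
have := IH tK'; have := @fS (Ordinal tK') (Ordinal tK) erefl.
rewrite /up_right_step /=.
case: (f (Ordinal tK)) (f (Ordinal tK')) => a b [c e] /=.
have := lpp_stepl v c e; have := lpp_stepr v c e.
by move=> ? ? /orP[|] /andP[/eqP -> /eqP ->]; lia.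
Qed.

(** A maximising path is obtained by always coming from the neighbour that attains the maximum. *)
Lemma up_right_sum_ge v i j : exists p : nat -> nat * nat,
  [/\ p 0 = (0, 0), p (i + j) = (i, j),
      forall t, t < i + j -> up_right_step (p t) (p t.+1),
      forall t, t <= i + j -> (p t).1 <= i /\ (p t).2 <= j &
      \sum_(t < (i + j).+1) v (p t).1 (p t).2 = lpp v i j].
Proof.
(* Appending one site to a maximising path; every inductive case uses it. *)
have ext i' j' i1 j1 p : i1 + j1 = (i' + j').+1 ->
    up_right_step (i', j') (i1, j1) -> lpp v i1 j1 = v i1 j1 + lpp v i' j' ->
    [/\ p 0 = (0, 0), p (i' + j') = (i', j'),
      forall t, t < i' + j' -> up_right_step (p t) (p t.+1),
      forall t, t <= i' + j' -> (p t).1 <= i' /\ (p t).2 <= j' &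
      \sum_(t < (i' + j').+1) v (p t).1 (p t).2 = lpp v i' j'] ->
   exists p : nat -> nat * nat,
  [/\ p 0 = (0, 0), p (i1 + j1) = (i1, j1),
      forall t, t < i1 + j1 -> up_right_step (p t) (p t.+1),
      forall t, t <= i1 + j1 -> (p t).1 <= i1 /\ (p t).2 <= j1 &
      \sum_(t < (i1 + j1).+1) v (p t).1 (p t).2 = lpp v i1 j1].
  move=> e st le [p0 pe pS pb psum].
  exists (fun t => if t <= i' + j' then p t else (i1, j1)).
  rewrite e ltnn; split=> //.
  - move=> t; rewrite ltnS => tl; rewrite tl.
    by have [/pS//| |->] := ltngtP t (i' + j'); [lia|rewrite pe].
  - move=> t tl; cbv beta; case: (leqP t (i' + j')) => tl' //.
    have := pb _ tl'; move: st; rewrite /up_right_step /=; lia.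
  - rewrite big_ord_recr/= ltnn le addnC -psum; congr (_ + _).
    by apply: eq_bigr => t _; rewrite -ltnS ltn_ord.
elim: i j => [|i IHi]; elim=> [|j IHj].
- by exists (fun=> (0, 0)); split=> //; rewrite big_ord1 lpp00.
- by case: IHj => p; apply: (ext 0 j); rewrite ?lpp0S ?addnS// /up_right_step /= !eqxx.
- by case: (IHi 0) => p; apply: (ext i 0); rewrite ?lppS0 ?addSn// /up_right_step /= !eqxx.
- case: (leqP (lpp v i j.+1) (lpp v i.+1 j)) => h.
    case: IHj => p; apply: (ext i.+1 j); rewrite ?addnS// /up_right_step /=; first lia.
    by rewrite lppSS; lia.
  case: (IHi j.+1) => p; apply: (ext i j.+1); rewrite ?addSn// /up_right_step /=; first lia.
  by rewrite lppSS; lia.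
Qed.

Lemma last_passageE T (xi : nat * nat -> T -> nat) n m w :
  last_passage xi n.+1 m.+1 w = lpp (fun i j => xi (i.+1, j.+1) w) n m.
Proof.
set v := fun i j => _.
have eK : n.+1 + m.+1 - 1 = (n + m).+1 by lia.
apply/eqP; rewrite eqn_leq; apply/andP; split.
  apply/bigmax_leqP => f /and3P[f0 fe fS].
  have lK : n + m < n.+1 + m.+1 - 1 by lia.
  pose g (j : 'I_(n.+1 + m.+1 - 1)) := (((f j).1 : nat), ((f j).2 : nat)).
  have g0 (j : 'I_(n.+1 + m.+1 - 1)) : j = 0 :> nat -> g j = (0, 0).
    move=> j0; have /forallP/(_ j)/implyP := f0; rewrite j0 eqxx => /(_ isT).
    by rewrite /path_pt /g => /eqP[-> ->].
  have gS (j k : 'I_(n.+1 + m.+1 - 1)) : k = j.+1 :> nat -> up_right_step (g j) (g k).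
    move=> jk; have /forallP/(_ j)/forallP/(_ k)/implyP := fS.
    by rewrite jk eqxx => /(_ isT); rewrite /up_right_step /= !eqSS.
  have := up_right_sum_le v g0 gS (Ordinal lK).
  have -> : g (Ordinal lK) = (n, m).
    have /forallP/(_ (Ordinal lK))/implyP := fe => /=.
    rewrite (_ : n + m == _) => [/(_ isT)|]; last by apply/eqP; lia.
    by rewrite /path_pt /g => /eqP[-> ->].
  rewrite (eq_bigl xpredT)// => j /=.
  by have := ltn_ord j; lia.
(* Conversely, a maximising path is cast into the finite type of paths; by [pb] its sites stay in
   the rectangle, so [inord] is faithful. *)
have [p [p0 pe pS pb <-]] := up_right_sum_ge v n m.
pose f : {ffun 'I_(n.+1 + m.+1 - 1) -> 'I_n.+1 * 'I_m.+1} :=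
  [ffun t : 'I_(n.+1 + m.+1 - 1) => (inord (p t).1, inord (p t).2)].
have fE (t : 'I_(n.+1 + m.+1 - 1)) : path_pt f t = ((p t).1.+1, (p t).2.+1).
  have [|? ?] := pb t; first by have := ltn_ord t; lia.
  by rewrite /path_pt ffunE /= !inordK.
apply: leq_trans (leq_bigmax_cond f _); last first.
  apply/and3P; split.
  - by apply/forallP => j; apply/implyP => /eqP j0; rewrite fE j0 p0.
  - apply/forallP => j; apply/implyP => /eqP j0; rewrite fE j0.
    by rewrite (_ : n.+1 + m.+1 - 2 = n + m) ?pe//; lia.
  - apply/forallP => j; apply/forallP => k; apply/implyP => /eqP jk.
    rewrite !fE /up_right_step /= !eqSS jk; apply: pS.
    by have := ltn_ord k; lia.
rewrite eq_leq//; under [RHS]eq_bigr do rewrite fE.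
by rewrite eK.
Qed.

Local Open Scope classical_set_scope.
Local Open Scope ring_scope.

(** * Finite products of geometric laws *)

Lemma cvgr_prod (R : realType) (I : Type) (r : seq I) (u : I -> nat -> R) (l : I -> R) :
  (forall i, u i n @[n --> \oo] --> l i) ->
  \prod_(i <- r) u i n @[n --> \oo] --> \prod_(i <- r) l i.
Proof.
move=> ul; elim: r => [|i r IH].
  by rewrite big_nil; under eq_fun do rewrite big_nil; exact: cvg_cst.
rewrite big_cons; under eq_fun do rewrite big_cons.
exact: cvgM.
Qed.

Section product_sum.
Context {R : realType} {I : finType}.
Implicit Types (f : I -> nat -> R) (s : I -> R).

(** Sum and product can be exchanged on these finite boxes, which are cofinal among finite sets by
    [box_ge]. *)
Let box K : seq {ffun I -> nat} :=
  [seq [ffun i => u i : nat] | u : {ffun I -> 'I_K}].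

Let box_uniq K : uniq (box K).
Proof.
rewrite map_inj_uniq ?enum_uniq// => u v /ffunP uv.
by apply/ffunP => i; have := uv i; rewrite !ffunE => /val_inj.
Qed.

Let sum_box f K : (\sum_(v \in [set` box K]) (\prod_i f i (v i))%:E)%E =
  (\prod_i \sum_(0 <= k < K) f i k)%:E.
Proof.
rewrite -fsbig_seq// big_map sumEFin big_enum/=; congr EFin.
under [RHS]eq_bigr do rewrite big_mkord.
rewrite bigA_distr_bigA; apply: eq_bigr => u _.
by apply: eq_bigr => i _; rewrite ffunE.
Qed.

Let box_ge (X : set {ffun I -> nat}) : finite_set X ->
  exists K, X `<=` [set` box K].
Proof.
move=> finX; pose K := (\max_(v <- finmap.enum_fset (fset_set X)) \max_i v i).+1.
exists K => v Xv /=.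
have vK i : (v i < K)%N.
  rewrite ltnS; apply: leq_trans (leq_bigmax_seq _ _ _) => //=.
    exact: (@leq_bigmax _ (fun i => v i)).
  by rewrite in_fset_set//; exact/mem_set.
apply/mapP; exists [ffun i => Ordinal (vK i)]; first by rewrite mem_enum.
by apply/ffunP => i; rewrite !ffunE.
Qed.

(** Upper bound: a finite set fits in a box, whose sum is a product of partial sums. Lower bound:
    the sums over boxes tend to the product of the limits. *)
Lemma esum_prod f s : (forall i k, 0 <= f i k) ->
  (forall i, series (f i) @ \oo --> s i) ->
  \esum_(v in [set: {ffun I -> nat}]) (\prod_i f i (v i))%:E = (\prod_i s i)%:E.
Proof.
move=> f0 fs.
have cvg := @cvgr_prod R I (index_enum I) (fun i => series (f i)) s fs.
have nd (i : I) : {homo series (f i) : n m / (n <= m)%N >-> n <= m}.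
  by apply/nondecreasing_seqP => n; rewrite /series/= big_nat_recr//= lerDl.
apply/eqP; rewrite eq_le; apply/andP; split.
  apply: ge_ereal_sup => _ [X [finX _] <-].
  have [K XK] := box_ge finX.
  apply: (@le_trans _ _ (\sum_(v \in [set` box K]) (\prod_i f i (v i))%:E)%E).
    apply: lee_fsum_nneg_subset => //; first exact: finite_seq.
      by move=> v /set_mem/XK/mem_set.
    by move=> v _; rewrite lee_fin prodr_ge0.
  rewrite sum_box lee_fin ler_prod// => i _; rewrite sumr_ge0//=.
  rewrite -(cvg_lim _ (fs i))//; apply: nondecreasing_cvgn_le => //.
  by apply/cvg_ex; exists (s i); exact: fs.
have cvgE : (\prod_i series (f i) n)%:E @[n --> \oo] --> (\prod_i s i)%:E.
  by apply: cvg_EFin; [exact: nearW|exact: cvg].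
rewrite -(cvg_lim _ cvgE)//; apply: lime_le.
  by apply/cvg_ex; exists (\prod_i s i)%:E.
apply: nearW => n; apply: esum_ge; exists [set` box n].
  by split=> //; exact: finite_seq.
by rewrite sum_box.
Qed.

End product_sum.

Section geometric_product.
Context {R : realType}.
Implicit Types (I J : finType).

Definition geom_wt I (q : I -> R) (v : {ffun I -> nat}) : R :=
  \prod_i ((1 - q i) * q i ^+ v i).

(** The configuration space is countable, so the law is a sum of point masses and every subset is an
    event. *)
Definition Pr I (q : I -> R) (A : set {ffun I -> nat}) : \bar R :=
  \esum_(v in A) (geom_wt q v)%:E.

Definition params01 I (q : I -> R) := forall i, 0 < q i < 1.

Lemma geom_wt_ge0 I (q : I -> R) v : params01 q -> 0 <= geom_wt q v.
Proof.
move=> q01; apply: prodr_ge0 => i _; have /andP[q0 q1] := q01 i.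
by rewrite mulr_ge0 ?exprn_ge0 ?subr_ge0 ?ltW.
Qed.

Lemma cvg_geom_law (q : R) : 0 < q < 1 ->
  series (fun k => (1 - q) * q ^+ k) @ \oo --> (1 : R).
Proof.
move=> /andP[q0 q1]; have := @cvg_geometric_series R (1 - q) q.
rewrite ger0_norm ?ltW// => /(_ q1); rewrite divff// subr_eq0.
by rewrite gt_eqF.
Qed.

Lemma Pr_setT I (q : I -> R) : params01 q -> Pr q setT = 1%E.
Proof.
move=> q01; rewrite /Pr /geom_wt (@esum_prod _ _ (fun i k => (1 - q i) * q i ^+ k) (fun=> 1)).
- by rewrite big1.
- move=> i k; have /andP[q0 q1] := q01 i.
  by rewrite mulr_ge0 ?exprn_ge0 ?subr_ge0 ?ltW.
- by move=> i; exact: cvg_geom_law.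
Qed.

Lemma le_Pr I (q : I -> R) A B : params01 q -> A `<=` B -> (Pr q A <= Pr q B)%E.
Proof.
move=> q01 AB; apply: ge_ereal_sup => _ [X [finX XA] <-].
by apply: ereal_sup_ubound; exists X => //; split=> //; exact: subset_trans AB.
Qed.

Lemma Pr_le1 I (q : I -> R) A : params01 q -> (Pr q A <= 1)%E.
Proof. by move=> q01; rewrite -(Pr_setT q01) le_Pr. Qed.

Lemma Pr_setU I (q : I -> R) A B : params01 q -> (Pr q (A `|` B) <= Pr q A + Pr q B)%E.
Proof.
move=> q01; rewrite /Pr (esumID A) => [|v _]; last by rewrite lee_fin geom_wt_ge0.
by apply: leeD; apply: le_Pr => // v [[]].
Qed.

Lemma Pr_sub2 I (q : I -> R) A B C (p1 p2 : R) : params01 q -> A `<=` B `|` C ->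
  (Pr q B <= p1%:E -> Pr q C <= p2%:E -> Pr q A <= (p1 + p2)%:E)%E.
Proof.
move=> q01 ABC Bp Cp; apply: (le_trans (le_Pr q01 ABC)).
by apply: (le_trans (Pr_setU _ _ q01)); rewrite EFinD leeD.
Qed.

Lemma Pr_bigcup I (q : I -> R) (A : nat -> set {ffun I -> nat}) n (p : R) :
  params01 q -> (forall k, (k < n)%N -> Pr q (A k) <= p%:E)%E ->
  (Pr q [set v | exists2 k, (k < n)%N & A k v] <= (n%:R * p)%:E)%E.
Proof.
move=> q01; elim: n => [|n IH] Ap.
  rewrite (_ : [set _ | _] = set0) ?/Pr ?esum_set0 ?mul0r// -subset0 => v [].
  by [].
apply: (@le_trans _ _ (Pr q ([set v | exists2 k, (k < n)%N & A k v] `|` A n))).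
  apply: le_Pr => // v [k]; rewrite ltnS leq_eqVlt => /orP[/eqP ->|kn] Akv.
    by right.
  by left; exists k.
apply: (le_trans (Pr_setU _ _ q01)); rewrite -natr1 mulrDl mul1r EFinD leeD//; last first.
  exact: Ap.
by apply: IH => // k kn; apply: Ap; exact: ltnW.
Qed.

(* Change of measure: [r] is the exponentially tilted law in the Chernoff bound. *)
Lemma Pr_tilt I (q r : I -> R) (K : R) A : params01 q -> params01 r -> 0 <= K ->
  (forall v, A v -> geom_wt q v <= K * geom_wt r v) -> (Pr q A <= K%:E)%E.
Proof.
move=> q01 r01 K0 le; apply: ge_ereal_sup => _ [X [finX XA] <-].
rewrite -[leRHS]mule1 -(Pr_setT r01).
apply: (@le_trans _ _ (K%:E * \sum_(v \in X) (geom_wt r v)%:E)%E).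
  rewrite !fsbig_finite// !sumEFin -EFinM lee_fin mulr_sumr.
  rewrite big_seq [leRHS]big_seq; apply: ler_sum => v vX; apply: le; apply: XA.
  by move: vX; rewrite in_fset_set// => /set_mem.
by apply: lee_wpmul2l; rewrite ?lee_fin//; apply: ereal_sup_ubound; exists X.
Qed.

Lemma Pr_reindex I (q : I -> R) (A : set {ffun I -> nat}) e :
  involutive e -> (forall v, geom_wt q (e v) = geom_wt q v) -> Pr q (e @^-1` A) = Pr q A.
Proof.
move=> eK ew; rewrite /Pr [RHS](reindex_esum (e @^-1` A) A e).
  by apply: eq_esum => v _; rewrite ew.
split=> //; first by move=> x y _ _ /(can_inj eK).
by move=> v Av; exists (e v); rewrite /= eK.
Qed.

Lemma Pr_marginal I J (q : I -> R) (h : J -> I) (A : set {ffun J -> nat}) :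
  params01 q -> injective h ->
  Pr q [set v | A [ffun j => v (h j)]] = Pr (q \o h) A.
Proof.
move=> q01 hI; rewrite /Pr.
pose hs (v : {ffun I -> nat}) : {ffun J -> nat} := [ffun j => v (h j)].
have fiber (u : {ffun J -> nat}) :
    \esum_(v in [set v | hs v = u]) (geom_wt q v)%:E = (geom_wt (q \o h) u)%:E.
  (* Lying in the fibre of [u] is a condition site by site, so [esum_prod] applies: a site in the
     image of [h] keeps one term of its series, any other site keeps them all and contributes 1. *)
  pose ok i k := [forall j, (h j == i) ==> (u j == k)].
  pose f i k := if ok i k then (1 - q i) * q i ^+ k else 0.
  pose s i := \prod_(j | h j == i) ((1 - q i) * q i ^+ u j).
  rewrite esum_mkcond (eq_esum (b := fun v : {ffun I -> nat} => (\prod_i f i (v i))%:E)); last first.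
    move=> v _; rewrite /f; case: ifPn.
      move=> /set_mem/= e; congr EFin; apply: eq_bigr => i _; rewrite ifT//.
      by apply/forallP => j; apply/implyP => /eqP <-; rewrite -e ffunE.
    move=> /negP ne; have [i ni] : exists i, ~~ ok i (v i).
      apply/existsP; rewrite -negb_forall; apply/negP => /forallP all_ok.
      apply/ne/mem_set/ffunP => j; rewrite ffunE.
      by have /forallP/(_ j) := all_ok (h j); rewrite eqxx => /eqP.
    by rewrite (bigD1 i)//= (negPf ni) mul0r.
  rewrite (@esum_prod _ _ f s); first last.
  - move=> i; rewrite /f /s /ok; case: (pickP (fun j => h j == i)) => [j /eqP hj|nj].
      rewrite (big_pred1 j); last by move=> j'; rewrite -hj /= (inj_eq hI).
      pose F k := if u j == k then (1 - q i) * q i ^+ k else 0.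
      have -> : (fun k => if [forall j0, (h j0 == i) ==> (u j0 == k)]
                  then (1 - q i) * q i ^+ k else 0) = F.
        apply/funext => k; rewrite /F; congr (if _ then _ else _).
        apply/forallP/idP => [/(_ j)|uj j']; first by rewrite hj eqxx.
        by rewrite -hj; apply/implyP => /eqP/hI ->.
      apply: (@cvg_trans _ ((fun=> (1 - q i) * q i ^+ u j) @ \oo)); last exact: cvg_cst.
      apply: near_eq_cvg; near=> n.
      rewrite /series/= (bigD1_seq (u j)) ?iota_uniq//=; last first.
        by rewrite mem_index_iota /=; near: n; exact: nbhs_infty_gt.
      by rewrite /F eqxx big1 ?addr0// => k; rewrite eq_sym => /negPf ->.
    have -> : (fun k => if [forall j0, (h j0 == i) ==> (u j0 == k)]
                then (1 - q i) * q i ^+ k else 0) = (fun k => (1 - q i) * q i ^+ k).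
      by apply/funext => k; rewrite ifT//; apply/forallP => j; rewrite nj.
    by rewrite big_pred0//; exact: cvg_geom_law.
  - move=> i k; rewrite /f; case: ifP => // _; have /andP[q0 q1] := q01 i.
    by rewrite mulr_ge0 ?exprn_ge0 ?subr_ge0 ?ltW.
  rewrite /geom_wt /s (exchange_big_dep xpredT)//=; congr EFin.
  by apply: eq_bigr => j _; rewrite (big_pred1 (h j))// => i; rewrite eq_sym.
(* The event is the disjoint union of the fibres over [u] in [A], summed as pairs (u, v). *)
rewrite -(eq_esum (fun u _ => fiber u)) esum_esum; last first.
  by move=> u v _ _; rewrite lee_fin geom_wt_ge0.
apply/esym; rewrite (reindex_esum (setT `&` [set v | A (hs v)]) _ (fun v => (hs v, v)))/=.
  by rewrite setTI.
split.
- by move=> v [_ /= Av].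
- by move=> v v' _ _ [].
- by move=> [u v] /= [Au e]; exists v; rewrite ?e//; split=> //=; rewrite e.
Unshelve. all: by end_near.
Qed.

End geometric_product.

(** * Chernoff bounds for geometric sums *)

Definition geom_mean {R : realType} (a : R) := a / (1 - a).

Section chernoff.
Context {R : realType}.
Implicit Types (I : finType) (a : R).

(** Tilting replaces [a] by [a * expR sig] on [s], each site giving one normalising factor. Positive
    [sig] serves the upper tail, negative [sig] the lower tail. *)
Lemma Pr_exp_markov I (q : I -> R) (s : seq I) a (sig t : R) :
  params01 q -> uniq s -> {in s, forall i, q i = a} -> 0 < a < 1 -> a * expR sig < 1 ->
  (Pr q [set v | (sig * t <= sig * (\sum_(i <- s) v i)%N%:R)%R] <=
   (expR (- (sig * t)) * ((1 - a) / (1 - a * expR sig)) ^+ size s)%:E)%E.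
Proof.
move=> q01 us qa /andP[a0 a1] ae1.
pose r i := if i \in s then a * expR sig else q i.
have r01 : params01 r.
  by move=> i; rewrite /r; case: ifP => // _; rewrite mulr_gt0 ?expR_gt0.
set X := (1 - a) / _.
have X0 : 0 <= X by rewrite divr_ge0// subr_ge0 ltW.
have ne0 : 1 - a * expR sig != 0 by rewrite subr_eq0 gt_eqF.
apply: (Pr_tilt q01 r01); first by rewrite mulr_ge0 ?expR_ge0 ?exprn_ge0.
move=> v /= vt.
have E : X ^+ size s * geom_wt r v = geom_wt q v * expR (sig * (\sum_(i <- s) v i)%N%:R).
  have -> : X ^+ size s = \prod_i if i \in s then X else 1.
    by rewrite -big_mkcond -big_uniq//= big_const_seq count_predT iter_mulr_1.
  rewrite natr_sum mulr_sumr expR_sum [X in _ = _ * X]big_uniq// [X in _ = _ * X]big_mkcond/=.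
  rewrite /geom_wt -!big_split/=; apply: eq_bigr => i _.
  rewrite /r; case: ifPn => si; rewrite ?mul1r ?mulr1// qa//.
  by rewrite /X exprMn expRM_natr; field.
rewrite -mulrA E mulrCA -expRD ler_peMr ?geom_wt_ge0// -[leLHS]expR0 ler_expR; lra.
Qed.

(** Invert expR (- x) >= 1 - x and use (1 - x)(1 + x + 2 x^2) = 1 + x^2 (1 - 2 x). *)
Lemma expR_le_quad (x : R) : x <= 1 / 2 -> expR x <= 1 + x + 2 * x ^+ 2.
Proof.
move=> x2; rewrite -[x in leLHS]opprK expRN.
have : 1 - x <= expR (- x) by have := expR_ge1Dx (- x).
have x1 : 0 < 1 - x by lra.
move=> le; apply: (@le_trans _ _ (1 - x)^-1).
  by rewrite lef_pV2// posrE expR_gt0.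
rewrite -[leLHS]mul1r ler_pdivrMr//.
have : 0 <= x ^+ 2 * (1 - 2 * x) by rewrite mulr_ge0 ?sqr_ge0//; lra.
rewrite expr2; nra.
Qed.

(** The logarithm of the moment generating function is [sig * geom_mean a] up to an error of order
    [sig ^+ 2], hence at most [s0 * kap] for small [s0]. One [s0] serves both signs. *)
Lemma geom_mgf_le a (kap : R) : 0 < a < 1 -> 0 < kap -> exists2 s0 : R, 0 < s0 &
  forall sig, `|sig| = s0 -> a * expR sig < 1 /\
    (1 - a) / (1 - a * expR sig) <= expR (sig * geom_mean a + s0 * kap).
Proof.
move=> /andP[a0 a1] k0.
have p0 : 0 < geom_mean a by rewrite divr_gt0 ?subr_gt0.
set p := geom_mean a in p0 *.
(* The terms of [D] are what [b1] (the range of [expR_le_quad]) and [b2] (the total quadratic error)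
   demand of s0 = kap / D. *)
pose D := kap * (2 * (1 + p + kap)) + 2 * p + 2 * (p + kap) ^+ 2.
have q2 : 0 < (p + kap) ^+ 2 by rewrite exprn_gt0// addr_gt0.
have q1 : 0 < kap * (2 * (1 + p + kap)) by rewrite mulr_gt0//; lra.
have D0 : 0 < D by rewrite /D; lra.
have s0p : 0 < kap / D by rewrite divr_gt0.
have sD : kap / D * D = kap by rewrite mulfVK// gt_eqF.
exists (kap / D) => // sig; move: sD s0p; set s0 := kap / D => sD s0p es.
have b1 : s0 * (1 + p + kap) <= 1 / 2.
  have : 0 <= s0 * (2 * p + 2 * (p + kap) ^+ 2).
    by apply: mulr_ge0; lra.
  move: sD; rewrite /D => sD h.
  have : kap * (s0 * (2 * (1 + p + kap))) <= kap * 1 by nra.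
  by rewrite ler_pM2l//; lra.
have b2 : s0 * (2 * p + 2 * (p + kap) ^+ 2) <= kap.
  have : 0 <= s0 * (kap * (2 * (1 + p + kap))).
    by apply: mulr_ge0; lra.
  by move: sD; rewrite /D; lra.
have sb : -s0 <= sig <= s0 by rewrite -ler_norml es.
have sq : sig ^+ 2 = s0 ^+ 2 by rewrite -es real_normK ?num_real.
have h1 : expR sig <= 1 + sig + 2 * s0 ^+ 2.
  by rewrite -sq; apply: expR_le_quad; nra.
pose y := sig * p + s0 * kap.
have yb : `|y| <= s0 * (p + kap) by rewrite ler_norml /y; apply/andP; split; nra.
have h2 : expR (- y) <= 1 - y + 2 * (s0 * (p + kap)) ^+ 2.
  apply: (le_trans (expR_le_quad _)).
    by move: yb; rewrite ler_norml => /andP[]; nra.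
  rewrite sqrrN lerD2l ler_pM2l// -[y ^+ 2]real_normK ?num_real//.
  by rewrite ler_sqr// nnegrE mulr_ge0 ?ltW ?addr_gt0.
(* By [e] below, the generating function is the inverse of the right-hand side, so this is the claim
   inverted. *)
have key : expR (- y) <= 1 - p * (expR sig - 1).
  apply: (le_trans h2).
  have : p * (expR sig - 1) <= p * (sig + 2 * s0 ^+ 2) by rewrite ler_pM2l//; lra.
  rewrite exprMn /y; move: b2; rewrite -(ler_pM2l s0p) => b2 b3; nra.
have e : 1 - a * expR sig = (1 - a) * (1 - p * (expR sig - 1)).
  by rewrite /p /geom_mean; field; rewrite subr_eq0 gt_eqF.
have key0 : 0 < 1 - p * (expR sig - 1) by apply: lt_le_trans key; exact: expR_gt0.
have a1' : 0 < 1 - a by lra.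
split; first by rewrite -subr_gt0 e mulr_gt0.
rewrite e invfM mulrA divff ?gt_eqF// mul1r -/y -[y]opprK expRN.
by rewrite lef_pV2// posrE expR_gt0.
Qed.

(** The rate is uniform over index types and over sums of at most [K * N] terms, as the union bounds
    demand. With tolerance [eta / (2 * K)] the error uses up only half of the exponent s0 eta N. *)
Lemma Pr_chernoff a (K eta : R) : 0 < a < 1 -> 0 < K -> 0 < eta ->
  exists2 c : R, 0 < c & forall I (q : I -> R) (s : seq I) (N : nat),
    params01 q -> uniq s -> {in s, forall i, q i = a} -> (size s)%:R <= K * N%:R ->
    (Pr q [set v | ((size s)%:R * geom_mean a + eta * N%:R <= (\sum_(i <- s) v i)%N%:R)%R]
       <= (expR (- c * N%:R))%:E)%E /\
    (Pr q [set v | ((\sum_(i <- s) v i)%N%:R <= (size s)%:R * geom_mean a - eta * N%:R)%R]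
       <= (expR (- c * N%:R))%:E)%E.
Proof.
move=> a01 K0 eta0; have [|s0 s00 H] := @geom_mgf_le a (eta / (2 * K)) a01.
  by rewrite divr_gt0// mulr_gt0.
exists (s0 * eta / 2); first by rewrite !mulr_gt0.
move=> I q s N q01 us qa sK.
have fin sig t : `|sig| = s0 -> - (sig * t) + (size s)%:R * (sig * geom_mean a) =
      - (s0 * (eta * N%:R)) ->
    (Pr q [set v | (sig * t <= sig * (\sum_(i <- s) v i)%N%:R)%R] <=
      (expR (- (s0 * eta / 2) * N%:R))%:E)%E.
  move=> es et; have [ae1 le] := H _ es.
  apply: (le_trans (Pr_exp_markov t q01 us qa a01 ae1)); rewrite lee_fin.
  apply: (@le_trans _ _ (expR (- (sig * t)) *
     expR (sig * geom_mean a + s0 * (eta / (2 * K))) ^+ size s)).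
    rewrite ler_pM2l ?expR_gt0//; apply: lerXn2r => //; rewrite nnegrE ?expR_ge0//.
    by move: a01 => /andP[a0 a1]; rewrite divr_ge0// subr_ge0 ltW.
  rewrite -expRM_natl -expRD ler_expR mulrDr addrA et.
  have : (size s)%:R * (s0 * (eta / (2 * K))) <= (K * N%:R) * (s0 * (eta / (2 * K))).
    by rewrite ler_wpM2r// mulr_ge0 ?ltW// divr_gt0// mulr_gt0.
  have -> : (K * N%:R) * (s0 * (eta / (2 * K))) = s0 * eta / 2 * N%:R.
    by field; rewrite gt_eqF.
  lra.
split.
- have := fin s0 ((size s)%:R * geom_mean a + eta * N%:R).
  rewrite gtr0_norm// => /(_ erefl) h; apply: le_trans (h _); last by ring.
  by apply: le_Pr => // v /=; rewrite ler_pM2l.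
- have := fin (- s0) ((size s)%:R * geom_mean a - eta * N%:R).
  rewrite normrN gtr0_norm// => /(_ erefl) h; apply: le_trans (h _); last by ring.
  by apply: le_Pr => // v /=; rewrite !mulNr lerN2 ler_pM2l.
Qed.

End chernoff.

(** * Burke property *)

Section flip.
Context {I : finType}.
Implicit Types (i j k : I) (v : {ffun I -> nat}).

(** The sites [i], [j], [k] carry the horizontal increment, the vertical increment and the cell
    weight. *)
Definition flip i j k v : {ffun I -> nat} := [ffun z =>
  if z == i then (v k + (v i - v j))%N else
  if z == j then (v k + (v j - v i))%N else
  if z == k then minn (v i) (v j) else v z].

(** The flip keeps the difference of the entries at [i] and [j], turns their minimum into the old
    entry at [k], and stores the old minimum at [k]. *)
Lemma flipK i j k : i != j -> i != k -> j != k -> involutive (flip i j k).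
Proof.
move=> ij ik jk v; apply/ffunP => z; rewrite !ffunE !eqxx.
rewrite [j == i]eq_sym [k == i]eq_sym [k == j]eq_sym (negPf ij) (negPf ik) (negPf jk).
by case: eqP => [->|_]; [|case: eqP => [->|_]; [|case: eqP => [->|_]]]; lia.
Qed.

(** As q k = q i q j, the weight of the three sites depends only on v i + v k and v j + v k, and the
    flip preserves both sums. *)
Lemma geom_wt_flip (R : realType) (q : I -> R) i j k v :
  i != j -> i != k -> j != k -> q k = q i * q j ->
  geom_wt q (flip i j k v) = geom_wt q v.
Proof.
move=> ij ik jk qk; rewrite /geom_wt !big_split/=; congr (_ * _).
rewrite (bigD1 i)//= [RHS](bigD1 i)//=.
rewrite (bigD1 j) 1?eq_sym//= [in RHS](bigD1 j) 1?eq_sym//=.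
rewrite (bigD1 k) 1?eq_sym//= 1?[k == j]eq_sym ?ik ?jk//=.
rewrite [in RHS](bigD1 k) 1?eq_sym//= 1?[k == j]eq_sym ?ik ?jk//=.
rewrite !ffunE !eqxx.
rewrite [j == i]eq_sym [k == i]eq_sym [k == j]eq_sym (negPf ij) (negPf ik) (negPf jk).
rewrite !mulrA; congr (_ * _).
  rewrite qk !exprMn !exprD.
  case: (leqP (v i) (v j)) => vij.
    have -> : q j ^+ v j = q j ^+ (v j - v i) * q j ^+ v i.
      by rewrite -exprD subnK.
    by rewrite (eqP vij) expr0; ring.
  have -> : q i ^+ v i = q i ^+ (v i - v j) * q i ^+ v j.
    by rewrite -exprD subnK// ltnW.
  by rewrite (eqP (ltnW vij)) expr0; ring.
apply: eq_bigr => z /andP[/andP[/negPf zi /negPf zj] /negPf zk].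
by rewrite ffunE zi zj zk.
Qed.

End flip.

Definition conf n m := {ffun 'I_n.+1 * 'I_m.+1 -> nat}.

(** Natural indices suit [lpp]; [inord] sends those out of range to 0, hence the bounds on indices
    in later statements. *)
Definition mat n m (x : conf n m) i j := x (inord i, inord j).

Section sweep.
Context {n m : nat}.
Implicit Types (x y : conf n m) (i j : nat).

Definition flip_cell i j : conf n m -> conf n m :=
  flip (inord i, inord 0) (inord 0, inord j) (inord i, inord j).

Fixpoint sweep_col i j x : conf n m :=
  if j is j'.+1 then flip_cell i j (sweep_col i j' x) else x.

Fixpoint sweep i x : conf n m :=
  if i is i'.+1 then sweep_col i m (sweep i' x) else x.

Let inord_eq p i j : (i <= p)%N -> (j <= p)%N ->
  (inord i == inord j :> 'I_p.+1) = (i == j).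
Proof. by move=> ip jp; rewrite -val_eqE /= !inordK. Qed.

Lemma mat_flip_cell i j x i' j' : (0 < i <= n)%N -> (0 < j <= m)%N ->
  (i' <= n)%N -> (j' <= m)%N ->
  mat (flip_cell i j x) i' j' =
    if (i' == i) && (j' == 0%N) then (mat x i j + (mat x i 0 - mat x 0 j))%N else
    if (i' == 0%N) && (j' == j) then (mat x i j + (mat x 0 j - mat x i 0))%N else
    if (i' == i) && (j' == j) then minn (mat x i 0) (mat x 0 j) else mat x i' j'.
Proof.
move=> /andP[_ ni] /andP[_ mj] ni' mj'.
by rewrite /mat /flip_cell ffunE !xpair_eqE !inord_eq.
Qed.

(* State of the sweep of column [i.+1] after its first [j] cells: the vertical
   axis carries the current column increments, [(i.+1, 0)] the current
   horizontal increment. *)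
Definition sweep_inv v i j y :=
  [/\ forall j', (j' < m)%N ->
        mat y 0 j'.+1 = if (j' < j)%N then vert_inc v i.+1 j' else vert_inc v i j',
      mat y i.+1 0 = horiz_inc v i j,
      forall j', (j < j' <= m)%N -> mat y i.+1 j' = v i.+1 j' &
      forall i' j', (i.+1 < i' <= n)%N -> (j' <= m)%N -> mat y i' j' = v i' j'].

Lemma sweep_inv_col v i j y : (i < n)%N -> (j <= m)%N ->
  sweep_inv v i 0 y -> sweep_inv v i j (sweep_col i.+1 j y).
Proof.
move=> ni; elim: j => [|j IH]// jm y0.
have [A B C D] := IH (ltnW jm) y0.
rewrite /=; set z := sweep_col i.+1 j y in A B C D *.
have ij : (0 < i.+1 <= n)%N by [].
have jj : (0 < j.+1 <= m)%N by [].
split.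
- move=> j' j'm; rewrite mat_flip_cell//= !eqSS.
  have [->|nj] := eqVneq j' j.
    by rewrite ltnSn A// ltnn B C ?vert_incS ?ltnSn.
  by rewrite A//; congr (if _ then _ else _); lia.
- by rewrite mat_flip_cell//= eqxx horiz_incS A// ltnn B C// ltnSn.
- move=> j' /andP[jj' j'm]; rewrite mat_flip_cell//= eqxx.
  have -> : (j' == 0%N) = false by lia.
  have -> : (j' == j.+1) = false by lia.
  by apply: C; lia.
- move=> i' j' /andP[ii' i'n] j'm; rewrite mat_flip_cell//=.
  have -> : (i' == 0%N) = false by lia.
  have -> : (i' == i.+1) = false by lia.
  by apply: D; lia.
Qed.

Lemma sweep_vert_inc x i : (i <= n)%N ->
  (forall j, (j < m)%N -> mat (sweep i x) 0 j.+1 = vert_inc (mat x) i j) /\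
  (forall i' j, (i < i' <= n)%N -> (j <= m)%N -> mat (sweep i x) i' j = mat x i' j).
Proof.
elim: i => [|i IH] ni.
  by split=> [j jm|//]; rewrite vert_inc0.
have [A B] := IH (ltnW ni).
have /(sweep_inv_col ni (leqnn m)) : sweep_inv (mat x) i 0 (sweep i x).
  split=> //; first by rewrite B ?horiz_inc0// ltnSn.
    by move=> j' /andP[_ jm]; rewrite B ?ltnSn.
  by move=> i' j' ii' jm; apply: B => //; lia.
move=> [C _ _ D] /=; split=> // j jm.
by rewrite C ?jm.
Qed.

Lemma Pr_sweep (R : realType) (q : 'I_n.+1 * 'I_m.+1 -> R) A i : params01 q ->
  (forall i j, (0 < i <= n)%N -> (0 < j <= m)%N ->
    q (inord i, inord j) = q (inord i, inord 0) * q (inord 0, inord j)) ->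
  (i <= n)%N -> Pr q (sweep i @^-1` A) = Pr q A.
Proof.
move=> q01 qM; elim: i A => // i IH A ni.
suff col j B : (j <= m)%N -> Pr q (sweep_col i.+1 j @^-1` B) = Pr q B.
  by rewrite -[RHS](col m)// -[RHS]IH// ltnW.
elim: j B => // j IHj B jm.
rewrite -[LHS]/(Pr q (sweep_col i.+1 j @^-1` (flip_cell i.+1 j.+1 @^-1` B))) IHj 1?ltnW//.
have n1 : (inord i.+1, inord 0) != (inord 0, inord j.+1) :> 'I_n.+1 * 'I_m.+1.
  by rewrite xpair_eqE inord_eq.
have n2 : (inord i.+1, inord 0) != (inord i.+1, inord j.+1) :> 'I_n.+1 * 'I_m.+1.
  by rewrite xpair_eqE !inord_eq// andbF.
have n3 : (inord 0, inord j.+1) != (inord i.+1, inord j.+1) :> 'I_n.+1 * 'I_m.+1.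
  by rewrite xpair_eqE inord_eq.
apply: Pr_reindex; first exact: flipK.
by move=> v; apply: geom_wt_flip => //; apply: qM.
Qed.

(** After the full sweep the vertical axis holds the increments along the last column, and the sweep
    preserves the law. *)
Lemma Pr_vert_inc (R : realType) (q : 'I_n.+1 * 'I_m.+1 -> R) (B : set nat) : params01 q ->
  (forall i j, (0 < i <= n)%N -> (0 < j <= m)%N ->
    q (inord i, inord j) = q (inord i, inord 0) * q (inord 0, inord j)) ->
  Pr q [set x | B (\sum_(0 <= j < m) vert_inc (mat x) n j)%N] =
  Pr q [set x | B (\sum_(1 <= j < m.+1) mat x 0 j)%N].
Proof.
move=> q01 qM; rewrite -[RHS](Pr_sweep _ q01 qM (leqnn n)); congr Pr.
apply/funext => x /=; congr B; rewrite big_add1/=.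
apply: eq_big_nat => j /andP[_ jm].
by have [-> //] := @sweep_vert_inc x n (leqnn n).
Qed.

End sweep.

(** * Tails *)

Section stationary.
Context {R : realType}.
Implicit Types (a b : R) (n m : nat).

(* The value at the corner is irrelevant, see [unpin]. *)
Definition stat_param n m a b (p : 'I_n.+1 * 'I_m.+1) : R :=
  if p.1 == 0%N :> nat then (if p.2 == 0%N :> nat then a * b else b)
  else if p.2 == 0%N :> nat then a else a * b.

Lemma params01_mul a b : 0 < a < 1 -> 0 < b < 1 -> 0 < a * b < 1.
Proof. by move=> /andP[a0 a1] /andP[b0 b1]; rewrite mulr_gt0// mulr_ilt1 ?ltW. Qed.

Lemma params01_stat n m a b : 0 < a < 1 -> 0 < b < 1 -> params01 (@stat_param n m a b).
Proof.
move=> a01 b01 p; rewrite /stat_param.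
by case: ifP => _; case: ifP => _ //; exact: params01_mul.
Qed.

Lemma stat_paramE n m a b i j : (i <= n)%N -> (j <= m)%N ->
  @stat_param n m a b (inord i, inord j) =
  if i == 0%N then (if j == 0%N then a * b else b)
  else if j == 0%N then a else a * b.
Proof. by move=> ni mj; rewrite /stat_param /= !inordK. Qed.

Definition hseq n m k : seq ('I_n.+1 * 'I_m.+1) :=
  [seq (inord i, inord 0) | i <- iota 1 k].

Definition vseq n m k : seq ('I_n.+1 * 'I_m.+1) :=
  [seq (inord 0, inord j) | j <- iota 1 k].

Lemma size_hseq n m k : size (hseq n m k) = k.
Proof. by rewrite size_map size_iota. Qed.

Lemma size_vseq n m k : size (vseq n m k) = k.
Proof. by rewrite size_map size_iota. Qed.

Lemma uniq_hseq n m k : (k <= n)%N -> uniq (hseq n m k).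
Proof.
move=> kn; rewrite map_inj_in_uniq ?iota_uniq// => i j.
rewrite !mem_iota => ik jk [] /(congr1 val); rewrite /= !inordK//; lia.
Qed.

Lemma uniq_vseq n m k : (k <= m)%N -> uniq (vseq n m k).
Proof.
move=> kn; rewrite map_inj_in_uniq ?iota_uniq// => i j.
rewrite !mem_iota => ik jk [] /(congr1 val); rewrite /= !inordK//; lia.
Qed.

Lemma sum_hseq n m k (x : conf n m) :
  (\sum_(p <- hseq n m k) x p = \sum_(1 <= i < k.+1) mat x i 0)%N.
Proof. by rewrite big_map /index_iota subn1. Qed.

Lemma sum_vseq n m k (x : conf n m) :
  (\sum_(p <- vseq n m k) x p = \sum_(1 <= j < k.+1) mat x 0 j)%N.
Proof. by rewrite big_map /index_iota subn1. Qed.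

Lemma stat_param_hseq n m k a b : (k <= n)%N ->
  {in hseq n m k, forall p, stat_param a b p = a}.
Proof.
move=> kn p /mapP[i]; rewrite mem_iota => ik ->.
by rewrite stat_paramE//= ?ifF//; lia.
Qed.

Lemma stat_param_vseq n m k a b : (k <= m)%N ->
  {in vseq n m k, forall p, stat_param a b p = b}.
Proof.
move=> kn p /mapP[i]; rewrite mem_iota => ik ->.
by rewrite stat_paramE//= ?ifF//; lia.
Qed.

Lemma Pr_block n m n' m' k l (q : 'I_n.+1 * 'I_m.+1 -> R) lam (B : set nat) :
  params01 q -> (n' + k <= n)%N -> (m' + l <= m)%N ->
  (forall i j, (i <= n')%N -> (j <= m')%N -> q (inord (i + k), inord (j + l)) = lam) ->
  Pr q [set x : conf n m | B (lpp (fun i j => mat x (i + k) (j + l)) n' m')] =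
  Pr (fun _ : 'I_n'.+1 * 'I_m'.+1 => lam) [set y : conf n' m' | B (lpp (mat y) n' m')].
Proof.
move=> q01 nk ml qE.
pose h (p : 'I_n'.+1 * 'I_m'.+1) : 'I_n.+1 * 'I_m.+1 := (inord (p.1 + k), inord (p.2 + l)).
have hI : injective h.
  move=> [i j] [i' j'] [] /(congr1 val) + /(congr1 val); rewrite /= !inordK.
  - move=> /eqP + /eqP; rewrite !eqn_add2r => /eqP/val_inj -> /eqP/val_inj -> //.
  - by have := ltn_ord j'; lia.
  - by have := ltn_ord j; lia.
  - by have := ltn_ord i'; lia.
  - by have := ltn_ord i; lia.
have -> : (fun=> lam) = q \o h.
  by apply/funext => -[i j]; rewrite /= /h qE//= -ltnS ltn_ord.
rewrite -(Pr_marginal _ q01 hI); congr Pr; apply/funext => x /=; congr B.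
apply: lpp_ext => i j ni mj.
by rewrite {2}/mat ffunE /h /= /mat !inordK.
Qed.

(** Reflection exchanges [a] and [b], which reduces exits from the vertical axis to exits from the
    horizontal one. *)
Lemma Pr_transpose n m a b (A : set (nat -> nat -> nat)) : 0 < a < 1 -> 0 < b < 1 ->
  Pr (@stat_param n m a b) [set x | A (mat x)] =
  Pr (@stat_param m n b a) [set y | A (fun i j => mat y j i)].
Proof.
move=> a01 b01.
pose h (p : 'I_n.+1 * 'I_m.+1) : 'I_m.+1 * 'I_n.+1 := (p.2, p.1).
have hI : injective h by move=> [i j] [i' j'] [-> ->].
have -> : @stat_param n m a b = @stat_param m n b a \o h.
  apply/funext => -[i j]; rewrite /stat_param /= mulrC.
  by case: eqP => _; case: eqP => _.
rewrite -(Pr_marginal _ (params01_stat b01 a01) hI); congr Pr.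
apply/funext => y /=; congr A; apply/funext => i; apply/funext => j.
by rewrite /mat ffunE.
Qed.

(** The i.i.d. field consists of the off-axis weights of a stationary model, for any factorisation
    of its parameter. *)
Lemma Pr_inner n m a b (B : set nat) : 0 < a < 1 -> 0 < b < 1 ->
  Pr (fun _ : 'I_n.+1 * 'I_m.+1 => a * b) [set y : conf n m | B (lpp (mat y) n m)] =
  Pr (@stat_param n.+1 m.+1 a b)
    [set x | B (lpp (fun i j => mat x (i + 1) (j + 1)) n m)].
Proof.
move=> a01 b01; rewrite (@Pr_block _ _ _ _ _ _ _ (a * b))//.
- exact: params01_stat.
- by rewrite addn1.
- by rewrite addn1.
- by move=> i j ni mj; rewrite stat_paramE !addn1.
Qed.

Lemma stat_param_mul n m a b i j : (0 < i <= n)%N -> (0 < j <= m)%N ->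
  @stat_param n m a b (inord i, inord j) =
  @stat_param n m a b (inord i, inord 0) * @stat_param n m a b (inord 0, inord j).
Proof.
move=> /andP[i0 ni] /andP[j0 mj]; rewrite !stat_paramE//=.
by rewrite !gtn_eqF.
Qed.

(** By [lpp_telescope] and [Pr_vert_inc] the passage time is a sum of two geometric sums; a union
    bound splits the deviation [eta] evenly between them. *)
Lemma stationary_tails a b (K eta : R) : 0 < a < 1 -> 0 < b < 1 -> 0 < K -> 0 < eta ->
  exists2 c : R, 0 < c & forall n m N, n%:R <= K * N%:R -> m%:R <= K * N%:R ->
  (Pr (@stat_param n m a b) [set x | (n%:R * geom_mean a + m%:R * geom_mean b + eta * N%:R <=
      (lpp (unpin (mat x)) n m)%:R)%R] <= (2 * expR (- c * N%:R))%:E)%E /\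
  (Pr (@stat_param n m a b) [set x | ((lpp (unpin (mat x)) n m)%:R <=
      n%:R * geom_mean a + m%:R * geom_mean b - eta * N%:R)%R] <= (2 * expR (- c * N%:R))%:E)%E.
Proof.
move=> a01 b01 K0 eta0; have e2 : 0 < eta / 2 by rewrite divr_gt0.
have [c1 c10 H1] := Pr_chernoff a01 K0 e2.
have [c2 c20 H2] := Pr_chernoff b01 K0 e2.
exists (Num.min c1 c2); first by rewrite lt_min c10.
move=> n m N nK mK; have qp := params01_stat a01 b01 (n := n) (m := m).
have [] := H1 _ (@stat_param n m a b) (hseq n m n) N qp (uniq_hseq _ (leqnn n))
  (stat_param_hseq a b (leqnn n)); first by rewrite size_hseq.
have [] := H2 _ (@stat_param n m a b) (vseq n m m) N qp (uniq_vseq _ (leqnn m))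
  (stat_param_vseq a b (leqnn m)); first by rewrite size_vseq.
rewrite size_hseq size_vseq => V1 V2 U1 U2.
have le1 : expR (- c1 * N%:R) <= expR (- Num.min c1 c2 * N%:R).
  by rewrite ler_expR ler_wpM2r// lerN2 ge_min lexx.
have le2 : expR (- c2 * N%:R) <= expR (- Num.min c1 c2 * N%:R).
  by rewrite ler_expR ler_wpM2r// lerN2 ge_min lexx orbT.
have V t := @Pr_vert_inc n m R (@stat_param n m a b) t qp (@stat_param_mul n m a b).
rewrite [2 * _]mulr_natl mulr2n; split.
- pose A : set (conf n m) :=
    [set x | n%:R * geom_mean a + eta / 2 * N%:R <= (\sum_(p <- hseq n m n) x p)%N%:R].
  pose B : set nat := [set k | m%:R * geom_mean b + eta / 2 * N%:R <= k%:R].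
  apply: (@Pr_sub2 _ _ _ _ A [set x | B (\sum_(0 <= j < m) vert_inc (mat x) n j)%N]) => //.
  + move=> x /=; rewrite lpp_telescope natrD -sum_hseq => h.
    case: (pselect (A x)); [by left|move=> /negP; rewrite -ltNge => h'; right].
    by rewrite /B /=; lra.
  + by apply: (le_trans U1); rewrite lee_fin.
  + rewrite V; apply: (@le_trans _ _ (expR (- c2 * N%:R))%:E); last by rewrite lee_fin.
    by apply: le_trans V1; apply: le_Pr => // x /=; rewrite /B /= sum_vseq.
- pose A : set (conf n m) :=
    [set x | (\sum_(p <- hseq n m n) x p)%N%:R <= n%:R * geom_mean a - eta / 2 * N%:R].
  pose B : set nat := [set k | k%:R <= m%:R * geom_mean b - eta / 2 * N%:R].
  apply: (@Pr_sub2 _ _ _ _ A [set x | B (\sum_(0 <= j < m) vert_inc (mat x) n j)%N]) => //.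
  + move=> x /=; rewrite lpp_telescope natrD -sum_hseq => h.
    case: (pselect (A x)); [by left|move=> /negP; rewrite -ltNge => h'; right].
    by rewrite /B /=; lra.
  + by apply: (le_trans U2); rewrite lee_fin.
  + rewrite V; apply: (@le_trans _ _ (expR (- c2 * N%:R))%:E); last by rewrite lee_fin.
    by apply: le_trans V2; apply: le_Pr => // x /=; rewrite /B /= sum_vseq.
Qed.

Lemma lpp_upper_tail a b (K eta : R) : 0 < a < 1 -> 0 < b < 1 -> 0 < K -> 0 < eta ->
  exists2 c : R, 0 < c & forall n m N, n.+1%:R <= K * N%:R -> m.+1%:R <= K * N%:R ->
  (Pr (fun _ : 'I_n.+1 * 'I_m.+1 => (a * b)%R)
     [set y : conf n m | (n.+1%:R * geom_mean a + m.+1%:R * geom_mean b + eta * N%:R <=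
      (lpp (mat y) n m)%:R)%R] <= (2 * expR (- c * N%:R))%:E)%E.
Proof.
move=> a01 b01 K0 eta0; have [c c0 H] := stationary_tails a01 b01 K0 eta0.
exists c => // n m N nK mK; have [+ _] := H _ _ _ nK mK; apply: le_trans.
rewrite (@Pr_inner n m a b [set k | (n.+1%:R * geom_mean a + m.+1%:R * geom_mean b +
  eta * N%:R <= k%:R)%R])//.
apply: le_Pr; first exact: params01_stat.
move=> x /= h; apply: (le_trans h); rewrite ler_nat; exact: lpp_inner.
Qed.

End stationary.

(** * Exits from the horizontal axis *)

Section lower_tail.
Context {R : realType}.
Implicit Types (a b : R) (n m : nat).

(* The hypothesis says that [x = a] is a critical point of
   [b1 * geom_mean x + b2 * geom_mean (a * b / x)], so lowering [b1] by [eps] makes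
   an increase of [x] of order [eps] profitable. *)
Lemma shifted_params a b (b1 b2 eps : R) : 0 < a < 1 -> 0 < b < 1 ->
  0 < b1 -> 0 < b2 -> b1 * a / (1 - a) ^+ 2 = b2 * b / (1 - b) ^+ 2 ->
  0 < eps <= b1 -> exists al ga : R,
  [/\ 0 < al < 1, 0 < ga < 1, al * ga = a * b, geom_mean a <= geom_mean al &
    (b1 - eps) * (geom_mean al - geom_mean a) + b2 * (geom_mean ga - geom_mean b) < 0].
Proof.
move=> /andP[a0 a1] /andP[b0 b1'] b10 b20 crit /andP[e0 eb1].
pose A := 1 - a; pose B := a * (1 - b).
have A0 : 0 < A by rewrite /A; lra.
have B0 : 0 < B by rewrite /B mulr_gt0//; lra.
(* [h] is the increase of [a]. With this value the last bracket below, h b1 (A + B) - eps A B - eps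
   A h, reduces to - eps A h. *)
pose h := eps * A * B / (b1 * (A + B)).
have h0 : 0 < h by apply: divr_gt0; do ?apply: mulr_gt0 => //; exact: addr_gt0.
have hE : h * (b1 * (A + B)) = eps * A * B.
  by rewrite /h mulfVK// gt_eqF// mulr_gt0// addr_gt0.
have hA : h < A.
  rewrite /h ltr_pdivrMr; last by rewrite mulr_gt0// addr_gt0.
  have : eps * (A * B) <= b1 * (A * B) by rewrite ler_wpM2r//; apply: mulr_ge0; exact: ltW.
  have : 0 < b1 * (A * A) by rewrite !mulr_gt0.
  by lra.
clearbody h.
have ah0 : 0 < a + h by lra.
have ah1 : 0 < 1 - (a + h) by rewrite /A in hA; lra.
have Bh : 0 < B + h by rewrite addr_gt0.
have abah : 0 < a + h - a * b by move: Bh; rewrite /B; lra.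
have phial : geom_mean (a + h) - geom_mean a = h / (A * (A - h)).
  by rewrite /geom_mean /A; field; apply/andP; split; rewrite gt_eqF//; lra.
have ane : a != 0 by rewrite gt_eqF.
have phiga : geom_mean (a * b / (a + h)) - geom_mean b = - (a * b * h) / (B * (B + h)).
  rewrite /geom_mean /B; field.
  by do ?[apply/andP; split]; rewrite ?gt_eqF//; lra.
exists (a + h), (a * b / (a + h)); split.
- by apply/andP; split; lra.
- apply/andP; split; first by rewrite divr_gt0// mulr_gt0.
  by rewrite ltr_pdivrMr//; lra.
- by rewrite mulrC divfK// gt_eqF.
- rewrite -subr_ge0 phial ltW//; apply: divr_gt0 => //.
  by apply: mulr_gt0 => //; rewrite subr_gt0.
rewrite phial phiga.
have crit' : b2 * (a * b) = b1 * B ^+ 2 / A ^+ 2.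
  have -> : b1 * B ^+ 2 / A ^+ 2 = (b1 * a / (1 - a) ^+ 2) * (a * (1 - b) ^+ 2).
    by rewrite /A /B; field; rewrite gt_eqF//; lra.
  by rewrite crit; field; rewrite gt_eqF//; lra.
have -> : (b1 - eps) * (h / (A * (A - h))) + b2 * (- (a * b * h) / (B * (B + h))) =
    h / (A ^+ 2 * (A - h) * (B + h)) *
    ((b1 - eps) * A * (B + h) - b1 * B * (A - h)).
  have -> : b2 * (- (a * b * h) / (B * (B + h))) =
      - (b2 * (a * b)) * (h / (B * (B + h))) by field; rewrite !gt_eqF.
  by rewrite crit'; field; rewrite !gt_eqF//; lra.
rewrite pmulr_rlt0; last by rewrite divr_gt0// !mulr_gt0// ?exprn_gt0// subr_gt0.
have : 0 < eps * (A * h) by rewrite !mulr_gt0.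
by move: hE; lra.
Qed.

Lemma expR_decay (C c c' : R) (N : nat) : 0 <= C -> c' <= c ->
  C * expR (- c * N%:R) <= C * expR (- c' * N%:R).
Proof.
by move=> C0 cc; rewrite ler_wpM2l// ler_expR ler_wpM2r// lerN2.
Qed.

(** Half of the rate absorbs the linear number of exits in the union bound. *)
Lemma lin_expR_decay (c : R) (N : nat) : 0 < c ->
  N%:R * expR (- c * N%:R) <= 2 / c * expR (- (c / 2) * N%:R).
Proof.
move=> c0; have -> : - c * N%:R = - (c / 2 * N%:R) + - (c / 2) * N%:R by field.
rewrite expRD mulrA ler_pM2r ?expR_gt0//.
rewrite expRN ler_pdivrMr ?expR_gt0// -(@ler_pM2l _ (c / 2)) ?divr_gt0//.
rewrite !mulrA (_ : c / 2 * 2 / c = 1) ?mul1r; last by field; rewrite gt_eqF.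
by apply: le_trans (expR_ge1Dx _); rewrite lerDr.
Qed.

Definition inner n m (x : conf n.+1 m.+1) : nat :=
  lpp (fun i j => mat x (i + 1) (j + 1)) n m.

(* Bound for the paths leaving the horizontal axis at its [k.+1]-st site. *)
Definition hexit n m (k : nat) (x : conf n.+1 m.+1) : nat :=
  (\sum_(1 <= i < k.+2) mat x i 0%N +
   lpp (fun i j => mat x (i + k.+1) (j + 1)) (n - k) m)%N.

(** An early exit collects too little on the axis to make up for a bulk deficit of [del * N]. A late
    exit is too short by the upper tail with the parameters of [shifted_params]. *)
Lemma hexit_unlikely a b (b1 b2 del : R) : 0 < a < 1 -> 0 < b < 1 ->
  0 < b1 -> 0 < b2 -> b1 * a / (1 - a) ^+ 2 = b2 * b / (1 - b) ^+ 2 -> 0 < del ->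
  let t := b1 * geom_mean a + b2 * geom_mean b in
  exists eta C c (N0 : R), [/\ 0 < eta, 0 <= C, 0 < c &
    forall (N : nat) n m, N0 <= N%:R -> n.+1%:R <= b1 * N%:R -> m.+1%:R <= b2 * N%:R ->
    (Pr (@stat_param R n.+1 m.+1 a b)
       [set x | (((inner x)%:R <= (t - del) * N%:R) /\
          exists2 k, (k < n.+1)%N & ((t - eta) * N%:R <= (hexit k x)%:R))%R]
     <= (C * expR (- c * N%:R))%:E)%E].
Proof.
have shift_le p k i : (k < p.+1)%N -> (i <= p - k)%N -> (i + k.+1 <= p.+1)%N by lia.
move=> a01 b01 b10 b20 crit del0 t.
have pa0 : 0 < geom_mean a by case/andP: a01 => ? ?; rewrite divr_gt0 ?subr_gt0.
(* Exits before [eps * N] have mean boundary weight at most del N / 4; the cap [b1] is for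
   [shifted_params]. *)
pose eps := Num.min b1 (del / (4 * geom_mean a)).
have eps0 : 0 < eps <= b1.
  have pa4 : 0 < 4 * geom_mean a by rewrite mulr_gt0.
  by rewrite /eps lt_min b10 (divr_gt0 del0 pa4) ge_min lexx.
have epsd : eps * geom_mean a <= del / 4.
  have : eps <= del / (4 * geom_mean a) by rewrite /eps ge_min lexx orbT.
  move=> /(ler_wpM2r (ltW pa0)) /le_trans; apply.
  by rewrite le_eqVlt; apply/orP; left; apply/eqP; field; rewrite gt_eqF.
have [al [ga [al01 ga01 alga phial gap]]] := shifted_params a01 b01 b10 b20 crit eps0.
set g := _ + _ in gap.
have g0 : 0 < - g by rewrite oppr_gt0.
(* The first bound serves early exits. The second leaves room for three errors [eta * N] and one
   rounding term within the gap - g N of late exits. *)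
pose eta := Num.min (del / 4) (- g / 4).
have eta0 : 0 < eta by rewrite /eta lt_min !divr_gt0.
have etad : eta <= del / 4 by rewrite /eta ge_min lexx.
have etag : eta <= - g / 4 by rewrite /eta ge_min lexx orbT.
have d2 : 0 < del / 2 by rewrite divr_gt0.
have [c1 c10 H1] := Pr_chernoff a01 b10 d2.
have [c2 c20 H2] := Pr_chernoff a01 b10 eta0.
have bb0 : 0 < b1 + b2 by rewrite addr_gt0.
have [c3 c30 H3] := lpp_upper_tail al01 ga01 bb0 eta0.
pose c4 := Num.min c2 c3.
have c40 : 0 < c4 by rewrite /c4 lt_min c20.
pose c := Num.min c1 (c4 / 2).
exists eta, (1 + b1 * 3 * (2 / c4)), c, (4 * geom_mean al / - g); split=> //.
- apply: addr_ge0 => //; apply: mulr_ge0; first by rewrite mulr_ge0// ltW.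
  by rewrite divr_ge0// ltW.
- by rewrite /c lt_min c10 (divr_gt0 c40).
move=> N n m NN0 nb1 mb2.
have qp := @params01_stat R n.+1 m.+1 a b a01 b01.
have NN : geom_mean al <= - g / 4 * N%:R.
  by move: NN0; rewrite ler_pdivrMr//; lra.
(* [E1] looks only at the first [K0] axis weights, which dominate the boundary part of every early
   exit at once. *)
pose K0 := minn (Num.truncn (eps * N%:R)) n.+1.
have K0n : (K0 <= n.+1)%N by rewrite geq_minr.
have epsN : 0 <= eps * N%:R by apply: mulr_ge0 => //; apply: ltW; case/andP: eps0.
have K0e : K0%:R <= eps * N%:R.
  apply: (@le_trans _ _ (Num.truncn (eps * N%:R))%:R).
    by rewrite ler_nat geq_minl.
  by rewrite truncn_le.
pose E1 : set (conf n.+1 m.+1) := [set x | K0%:R * geom_mean a + del / 2 * N%:R <=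
  (\sum_(p <- hseq n.+1 m.+1 K0) x p)%N%:R].
pose F k : set (conf n.+1 m.+1) := [set x | k.+1%:R * geom_mean a + eta * N%:R <=
  (\sum_(p <- hseq n.+1 m.+1 k.+1) x p)%N%:R].
pose B k : set nat := [set z | (n - k).+1%:R * geom_mean al + m.+1%:R * geom_mean ga +
  eta * N%:R <= z%:R].
pose G k : set (conf n.+1 m.+1) :=
  [set x | B k (lpp (fun i j => mat x (i + k.+1) (j + 1)) (n - k) m)].
have PE1 : (Pr (@stat_param R n.+1 m.+1 a b) E1 <= (1 * expR (- c1 * N%:R))%:E)%E.
  have [] := H1 _ (@stat_param R n.+1 m.+1 a b) (hseq n.+1 m.+1 K0) N qp
    (uniq_hseq _ K0n) (stat_param_hseq a b K0n); rewrite size_hseq.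
    by apply: le_trans nb1; rewrite ler_nat.
  by rewrite mul1r.
have PFG k : (k < n.+1)%N ->
    (Pr (@stat_param R n.+1 m.+1 a b) (F k `|` G k) <= (3 * expR (- c4 * N%:R))%:E)%E.
  move=> kn.
  have -> : 3 * expR (- c4 * N%:R) = 1 * expR (- c4 * N%:R) + 2 * expR (- c4 * N%:R).
    by ring.
  apply: (@Pr_sub2 _ _ _ _ (F k) (G k)) => //.
    have [] := H2 _ (@stat_param R n.+1 m.+1 a b) (hseq n.+1 m.+1 k.+1) N qp
      (uniq_hseq _ kn) (stat_param_hseq a b kn); rewrite size_hseq.
      by apply: le_trans nb1; rewrite ler_nat.
    move=> + _ => /le_trans; apply; rewrite lee_fin -[leLHS]mul1r.
    by apply: expR_decay => //; rewrite /c /c4 ge_min lexx.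
  rewrite /G (@Pr_block _ _ _ _ _ _ _ _ (a * b))//; last 3 first.
  - exact: shift_le.
  - by rewrite addn1.
  - by move=> i j ni mj; rewrite stat_paramE ?addn1 ?shift_le// !addnS.
  rewrite -alga; have := H3 (n - k)%N m N; rewrite -/(B k).
  have hn : (n - k).+1%:R <= (b1 + b2) * N%:R.
    apply: (@le_trans _ _ n.+1%:R); first by rewrite ler_nat ltnS leq_subr.
    by apply: (le_trans nb1); rewrite ler_wpM2r// lerDl ltW.
  have hm : m.+1%:R <= (b1 + b2) * N%:R.
    by apply: (le_trans mb2); rewrite ler_wpM2r// lerDr ltW.
  move=> /(_ hn hm) /le_trans; apply; rewrite lee_fin.
  by apply: expR_decay => //; rewrite /c /c4 ge_min lexx orbT.
apply: (@le_trans _ _ (1 * expR (- c1 * N%:R) + n.+1%:R * (3 * expR (- c4 * N%:R)))%:E).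
  apply: (@Pr_sub2 _ _ _ _ E1 [set x | exists2 k, (k < n.+1)%N & (F k `|` G k) x]) => //.
    move=> x /= [xin [k kn xk]].
    case: (pselect (F k x)) => [Fk|/negP nF]; first by right; exists k => //; left.
    case: (pselect (G k x)) => [Gk|/negP nG]; first by right; exists k => //; right.
    left; rewrite /E1 /=.
    move: nF nG; rewrite -!ltNge sum_hseq => nF nG.
    (* Early exit: the part after the exit is at most [inner x], so the axis weights must supply the
       missing (del - eta) N. *)
    have [ke|ke] := leP k.+1%:R (eps * N%:R).
      have kK : (k.+1 <= K0)%N by rewrite leq_min kn andbT truncn_ge_nat.
      have Li : (lpp (fun i j => mat x (i + k.+1) (j + 1)) (n - k) m <= inner x)%N.
        have := lpp_shift (fun i j => mat x (i + 1) (j + 1)) k 0 (n - k) m.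
        rewrite subnK// addn0; congr (_ <= _)%N; apply: lpp_ext => i j _ _.
        by rewrite addn0 -addnA addn1.
      have Si : (\sum_(1 <= i < k.+2) mat x i 0 <= \sum_(1 <= i < K0.+1) mat x i 0)%N.
        by rewrite [leqRHS](@big_cat_nat _ _ _ k.+2)//= leq_addr.
      rewrite sum_hseq; move: xk xin Li Si.
      rewrite /hexit natrD -!(ler_nat R) => xk xin Li Si.
      have := ler_wpM2r (ltW pa0) K0e; have := ler_wpM2r (ler0n R N) epsd.
      by have := ler_wpM2r (ler0n R N) etad; lra.
    (* Late exit: as [geom_mean a <= geom_mean al], the bound is largest at k + 1 = eps N, where it
       is (t + g + 2 eta) N plus the rounding term [geom_mean al]. *)
    exfalso; move: xk; rewrite /hexit natrD => xk.
    have P1 : (n - k).+1%:R * geom_mean al <= (b1 * N%:R - k.+1%:R + 1) * geom_mean al.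
      rewrite ler_wpM2r ?(le_trans (ltW pa0))//.
      by rewrite -natr1 natrB//; move: nb1; rewrite -!natr1; lra.
    have P2 : m.+1%:R * geom_mean ga <= b2 * N%:R * geom_mean ga.
      rewrite ler_wpM2r//.
      by case/andP: ga01 => ? ?; rewrite divr_ge0 ?subr_ge0// ltW.
    have P3 : 0 <= (k.+1%:R - eps * N%:R) * (geom_mean al - geom_mean a).
      by rewrite mulr_ge0 ?subr_ge0// ltW.
    have P4 := ler_wpM2r (ler0n R N) etag.
    move: P1 P2 P3 P4 NN xk nF nG; rewrite /B /= /g /t; lra.
  by apply: Pr_bigcup.
rewrite lee_fin [leRHS]mulrDl; apply: lerD.
  by apply: expR_decay => //; rewrite /c /c4 ge_min lexx.
have -> : b1 * 3 * (2 / c4) * expR (- c * N%:R) =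
  b1 * 3 * (2 / c4 * expR (- c * N%:R)) by ring.
apply: (@le_trans _ _ (b1 * 3 * (N%:R * expR (- c4 * N%:R)))).
  have -> : b1 * 3 * (N%:R * expR (- c4 * N%:R)) =
    (b1 * N%:R) * (3 * expR (- c4 * N%:R)) by ring.
  by rewrite ler_wpM2r// mulr_ge0// expR_ge0.
rewrite ler_wpM2l ?mulr_ge0 ?(ltW b10)//.
apply: (le_trans (lin_expR_decay _ c40)).
apply: expR_decay; first by rewrite divr_ge0// ltW.
by rewrite /c ge_min lexx orbT.
Qed.

End lower_tail.

(** * Lower tail in the bulk and choice of parameters *)

Section shape.
Context {R : realType}.
Implicit Types (a b : R) (n m : nat).

(** If the stationary time is typical, [lpp_exit] gives an exit of value at least (t - eta) N; with
    a small bulk time this is unlikely for either axis. The slack [r] absorbs the rounding of the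
    side lengths. *)
Lemma lpp_lower_tail a b (b1 b2 del r : R) : 0 < a < 1 -> 0 < b < 1 ->
  0 < b1 -> 0 < b2 -> b1 * a / (1 - a) ^+ 2 = b2 * b / (1 - b) ^+ 2 -> 0 < del ->
  let t := b1 * geom_mean a + b2 * geom_mean b in
  exists C c (N0 : R), [/\ 0 <= C, 0 < c &
    forall (N : nat) n m, N0 <= N%:R -> n.+1%:R <= b1 * N%:R -> m.+1%:R <= b2 * N%:R ->
    t * N%:R - r <= n.+1%:R * geom_mean a + m.+1%:R * geom_mean b ->
    (Pr (fun _ : 'I_n.+1 * 'I_m.+1 => (a * b)%R)
       [set y : conf n m | ((lpp (mat y) n m)%:R <= (t - del) * N%:R)%R]
     <= (C * expR (- c * N%:R))%:E)%E].
Proof.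
move=> a01 b01 b10 b20 crit del0 t.
have [eta1 [C1 [c1 [N1 [eta10 C10 c10 H1]]]]] := hexit_unlikely a01 b01 b10 b20 crit del0.
have [eta2 [C2 [c2 [N2 [eta20 C20 c20 H2]]]]] :=
  hexit_unlikely b01 a01 b20 b10 (esym crit) del0.
pose eta := Num.min eta1 eta2.
have eta0 : 0 < eta by rewrite /eta lt_min eta10.
have le1 : eta <= eta1 by rewrite /eta ge_min lexx.
have le2 : eta <= eta2 by rewrite /eta ge_min lexx orbT.
have bb0 : 0 < b1 + b2 by rewrite addr_gt0.
have eta20' : 0 < eta / 2 by rewrite divr_gt0.
have [c3 c30 H3] := stationary_tails a01 b01 bb0 eta20'.
pose c := Num.min c3 (Num.min c1 c2).
have c0 : 0 < c by rewrite /c !lt_min c30 c10.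
exists (2 + (C1 + C2)), c, (Num.max (2 * r / eta) (Num.max N1 N2)); split=> //.
  by rewrite !addr_ge0.
move=> N n m; rewrite !ge_max => /and3P[Nr NN1 NN2] nb1 mb2 tr.
have qp := @params01_stat R n.+1 m.+1 a b a01 b01.
rewrite (@Pr_inner R n m a b [set k | k%:R <= (t - del) * N%:R])//.
pose Eh : set (conf n.+1 m.+1) := [set x | (inner x)%:R <= (t - del) * N%:R /\
   exists2 k, (k < n.+1)%N & (t - eta1) * N%:R <= (hexit k x)%:R].
pose t' := b2 * geom_mean b + b1 * geom_mean a.
have tt : t' = t by rewrite /t' /t addrC.
pose Ev : set (conf m.+1 n.+1) := [set x | (inner x)%:R <= (t' - del) * N%:R /\
   exists2 k, (k < m.+1)%N & (t' - eta2) * N%:R <= (hexit k x)%:R].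
(* Stated on matrices, so that [Pr_transpose] turns it into the horizontal event with [a] and [b]
   exchanged. *)
pose V : set (nat -> nat -> nat) := [set u |
   (lpp (fun i j => u (i + 1)%N (j + 1)%N) n m)%:R <= (t - del) * N%:R /\
   exists2 k, (k < m.+1)%N & (t - eta2) * N%:R <=
     (\sum_(1 <= j < k.+2) u 0%N j + lpp (fun i j => u (i + 1)%N (j + k.+1)%N) n (m - k))%N%:R].
have PV : (Pr (@stat_param R n.+1 m.+1 a b) [set x | V (mat x)] <= (C2 * expR (- c2 * N%:R))%:E)%E.
  rewrite Pr_transpose//; apply: le_trans (H2 N m n NN2 mb2 nb1).
  apply: le_Pr; first exact: params01_stat.
  move=> x /= [xin [k km xk]]; rewrite -/t' tt; split.
    by move: xin; rewrite /inner -lpp_transpose.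
  by exists k => //; move: xk; rewrite /hexit -lpp_transpose.
pose S : set (conf n.+1 m.+1) := [set x | (lpp (unpin (mat x)) n.+1 m.+1)%:R <=
      n.+1%:R * geom_mean a + m.+1%:R * geom_mean b - eta / 2 * N%:R].
have PS : (Pr (@stat_param R n.+1 m.+1 a b) S <= (2 * expR (- c3 * N%:R))%:E)%E.
  have [] := H3 n.+1 m.+1 N; last by [].
    by apply: (le_trans nb1); rewrite ler_wpM2r// lerDl ltW.
  by apply: (le_trans mb2); rewrite ler_wpM2r// lerDr ltW.
have key : [set x : conf n.+1 m.+1 |
      (lpp (fun i j => mat x (i + 1) (j + 1)) n m)%:R <= (t - del) * N%:R] `<=`
    S `|` (Eh `|` [set x | V (mat x)]).
  move=> x /= xin; case: (pselect (S x)) => [|/negP]; first by left.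
  rewrite -ltNge => nS; right.
  have big : (t - eta) * N%:R <= (lpp (unpin (mat x)) n.+1 m.+1)%:R.
    have : r <= eta / 2 * N%:R by move: Nr; rewrite ler_pdivrMr//; lra.
    by move: nS tr; lra.
  have m1 : (t - eta1) * N%:R <= (t - eta) * N%:R by rewrite ler_wpM2r// lerD2l lerN2.
  have m2 : (t - eta2) * N%:R <= (t - eta) * N%:R by rewrite ler_wpM2r// lerD2l lerN2.
  case: (lpp_exit (mat x) n m) => [[k kn le]|[k km le]]; [left|right]; split=> //;
    exists k => //.
    by apply: (le_trans m1); apply: (le_trans big); rewrite /hexit ler_nat.
  by apply: (le_trans m2); apply: (le_trans big); rewrite ler_nat.
have := Pr_sub2 qp key PS (Pr_sub2 qp (@subset_refl _ _) (H1 N n m NN1 nb1 mb2) PV).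
move=> /le_trans; apply; rewrite lee_fin [leRHS]mulrDl [X in _ <= _ + X]mulrDl.
by apply: lerD; [|apply: lerD]; apply: expR_decay; rewrite // /c !ge_min lexx ?orbT.
Qed.

Lemma lpp_shape_tails (lam beta del : R) : 0 < lam < 1 -> 0 < beta -> 0 < del ->
  let ell := (1 + Num.sqrt (beta * lam)) ^+ 2 / (1 - lam) - 1 in
  exists C c : R, [/\ 0 < C, 0 < c & forall N n m : nat, N = n.+1 ->
    Num.truncn (beta * N%:R) = m.+1 ->
    (Pr (fun _ : 'I_n.+1 * 'I_m.+1 => lam)
       [set y : conf n m | (del < `|(lpp (mat y) n m)%:R / N%:R - ell|)%R]
     <= (C * expR (- c * N%:R))%:E)%E].
Proof.
move=> /andP[l0 l1] beta0 del0 ell.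
pose s := Num.sqrt (beta * lam).
have s0 : 0 < s by rewrite sqrtr_gt0 mulr_gt0.
have s2 : s ^+ 2 = beta * lam by rewrite sqr_sqrtr// mulr_ge0 ?ltW.
have ls : 0 < lam + s by rewrite addr_gt0.
have s1 : 0 < 1 + s by lra.
have l1' : 0 < 1 - lam by lra.
have sl : 0 < s * (1 - lam) by rewrite mulr_gt0.
(* The critical point of geom_mean x + beta geom_mean (lam / x), where this function takes the value
   [ell]; see [crit] and [tE]. *)
pose a := (lam + s) / (1 + s); pose b := lam * (1 + s) / (lam + s).
have ab : a * b = lam by rewrite /a /b; field; rewrite !gt_eqF.
have a01 : 0 < a < 1.
  by apply/andP; split; rewrite /a; [exact: divr_gt0|rewrite ltr_pdivrMr//; lra].
have b01 : 0 < b < 1.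
  apply/andP; split; rewrite /b; first by apply: divr_gt0 => //; exact: mulr_gt0.
  by rewrite ltr_pdivrMr//; lra.
have a1E : 1 - a = (1 - lam) / (1 + s) by rewrite /a; field; rewrite gt_eqF.
have b1E : 1 - b = s * (1 - lam) / (lam + s) by rewrite /b; field; rewrite gt_eqF.
have betaE : beta = s ^+ 2 / lam by rewrite s2 mulfK// gt_eqF.
have pa : geom_mean a = (lam + s) / (1 - lam).
  by rewrite /geom_mean a1E /a; field; rewrite !gt_eqF.
have pb : geom_mean b = lam * (1 + s) / (s * (1 - lam)).
  by rewrite /geom_mean b1E /b; field; rewrite !gt_eqF.
have crit : 1 * a / (1 - a) ^+ 2 = beta * b / (1 - b) ^+ 2.
  by rewrite a1E b1E betaE /a /b; field; rewrite !gt_eqF.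
have tE : 1 * geom_mean a + beta * geom_mean b = ell.
  by rewrite pa pb betaE /ell -/s; field; rewrite !gt_eqF.
have pa0 : 0 < geom_mean a by rewrite pa divr_gt0.
have pb0 : 0 < geom_mean b by rewrite pb; apply: divr_gt0 => //; exact: mulr_gt0.
have bb0 : 0 < 1 + beta by rewrite addr_gt0.
have [c1 c10 H1] := lpp_upper_tail a01 b01 bb0 del0.
(* Rounding [beta * N] down costs less than one row, that is, less than [geom_mean b]. *)
have [C2 [c2 [N0 [C20 c20 H2]]]] :=
  lpp_lower_tail (geom_mean b) a01 b01 ltr01 beta0 crit del0.
pose c := Num.min c1 c2.
have c0 : 0 < c by rewrite /c lt_min c10.
(* The term [expR (c * N0)] makes the bound exceed 1 when N < N0. *)
exists (2 + C2 + expR (c * N0)), c; split=> //.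
  by rewrite ltr_wpDl ?expR_gt0// addr_ge0.
move=> N n m Nn tm.
have lam_par : params01 (fun _ : 'I_n.+1 * 'I_m.+1 => lam) by move=> i; rewrite l0.
have [NN|NN] := leP N0 N%:R; last first.
  apply: (le_trans (Pr_le1 _ lam_par)); rewrite lee_fin mulrDl.
  apply: (@le_trans _ _ (expR (c * N0) * expR (- c * N%:R))).
    rewrite -expRD -[leLHS]expR0 ler_expR.
    have : c * N%:R <= c * N0 by rewrite ler_wpM2l// ltW.
    by lra.
  by rewrite lerDr mulr_ge0 ?expR_ge0// addr_ge0.
have bN : 0 <= beta * N%:R by rewrite mulr_ge0// ltW.
have := truncn_itv bN; rewrite tm => /andP[mlo mhi].
have nb1 : n.+1%:R <= 1 * N%:R :> R by rewrite mul1r Nn.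
have N0p : 0 < N%:R :> R by rewrite Nn ltr0Sn.
rewrite -ab in lam_par *.
have PU := H1 n m N; have PL := H2 N n m NN nb1 mlo.
have h1 : n.+1%:R <= (1 + beta) * N%:R.
  by apply: (le_trans nb1); rewrite ler_wpM2r// lerDl ltW.
have h2 : m.+1%:R <= (1 + beta) * N%:R.
  by apply: (le_trans mlo); rewrite ler_wpM2r// lerDr.
have mpb : m.+1%:R * geom_mean b <= beta * N%:R * geom_mean b by rewrite ler_wpM2r// ltW.
have mpb' : (beta * N%:R - 1) * geom_mean b <= m.+1%:R * geom_mean b.
  by rewrite ler_wpM2r ?(ltW pb0)//; move: mhi; rewrite -[in X in _ < X]natr1; lra.
have nN : n.+1%:R = N%:R :> R by rewrite Nn.
have tr : (1 * geom_mean a + beta * geom_mean b) * N%:R - geom_mean b <=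
    n.+1%:R * geom_mean a + m.+1%:R * geom_mean b.
  by rewrite nN; lra.
have := Pr_sub2 lam_par _ (PU h1 h2) (PL tr).
move=> H; apply: (le_trans (H _ _)).
  move=> y /=; rewrite tE ltr_normr => /orP[h|h]; [left|right].
    have : del * N%:R <= (lpp (mat y) n m)%:R - ell * N%:R.
      have := ltW h; rewrite -(ler_pM2r N0p) mulrBl divfK// gt_eqF//.
    by rewrite nN -tE; lra.
  have : del * N%:R <= - ((lpp (mat y) n m)%:R - ell * N%:R).
    have := ltW h; rewrite -(ler_pM2r N0p) mulNr mulrBl divfK// gt_eqF//.
  by lra.
rewrite lee_fin [leRHS]mulrDl; apply: ler_wpDr; first by rewrite mulr_ge0 ?expR_ge0.
rewrite [leRHS]mulrDl; apply: lerD; apply: expR_decay => //; by rewrite /c ge_min lexx ?orbT.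
Qed.

End shape.

(** * Transfer to the given random variables and almost sure convergence *)

Section random_environment.
Context d (T : measurableType d) (R : realType) (P : probability T R).

Definition env (xi : nat * nat -> T -> nat) n m (w : T) : conf n m :=
  [ffun p : 'I_n.+1 * 'I_m.+1 => xi ((p.1 : nat).+1, (p.2 : nat).+1) w].

(** The event is a countable union of atoms [E v], each of probability [geom_wt] by independence;
    subadditivity then gives the inequality. *)
Lemma env_law xi (lam : R) n m (A : set (conf n m)) : 0 < lam < 1 ->
  (forall y, site y -> measurable_fun setT (xi y)) -> iid_indep P xi ->
  (forall y, site y -> geometric_law P lam (xi y)) ->
  measurable (@env xi n m @^-1` A) /\
  (P (@env xi n m @^-1` A) <= Pr (fun=> lam) A)%E.
Proof.
move=> lam01 mxi ixi gxi.
have lam_par : params01 (fun _ : 'I_n.+1 * 'I_m.+1 => lam) by [].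
pose st (p : 'I_n.+1 * 'I_m.+1) : nat * nat := ((p.1 : nat).+1, (p.2 : nat).+1).
have stI : injective st by move=> [i j] [i' j'] [] /val_inj -> /val_inj ->.
pose E (v : conf n m) : set T := [set w | env xi n m w = v].
have EE v : E v = \bigcap_(p in [set: 'I_n.+1 * 'I_m.+1]) (xi (st p) @^-1` [set v p]).
  apply/seteqP; split=> w /=.
    by move=> <- p _ /=; rewrite ffunE.
  by move=> h; apply/ffunP => p; rewrite ffunE; apply: h.
have mE v : measurable (E v).
  rewrite EE; apply: fin_bigcap_measurable; first exact: finite_finset.
  by move=> p _; rewrite -[X in measurable X]setTI; apply: mxi.
have PE v : P (E v) = (geom_wt (fun=> lam) v)%:E.
  (* Sites start at 1 and grid indices at 0, hence the predecessors. *)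
  pose B (y : nat * nat) : set nat := [set v (inord y.1.-1, inord y.2.-1)].
  have BE p : B (st p) = [set v p].
    by rewrite /B /st /= !inord_val; case: p.
  have := ixi [seq st p | p <- enum {: 'I_n.+1 * 'I_m.+1}] B.
  rewrite map_inj_uniq// enum_uniq => /(_ isT).
  have -> : all site [seq st p | p <- enum {: 'I_n.+1 * 'I_m.+1}].
    by apply/allP => _ /mapP[p _ ->].
  move=> /(_ isT) h; transitivity (P [set w | forall y,
      y \in [seq st p | p <- enum {: 'I_n.+1 * 'I_m.+1}] -> B y (xi y w)]).
    congr (P _); rewrite EE; apply/seteqP; split=> w /=.
      by move=> hw y /mapP[p _ ->]; rewrite BE; apply: hw.
    by move=> hw p _ /=; have := hw (st p); rewrite BE; apply; rewrite map_f ?mem_enum.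
  rewrite h big_map big_enum /geom_wt -prodEFin; apply: eq_bigr => p _ /=.
  by rewrite BE gxi.
(* The atoms are enumerated by their codes; a code outside [A] gives the empty set. *)
pose F k : set T := if pickle_inv k is Some v then (if v \in A then E v else set0) else set0.
have mF k : measurable (F k).
  by rewrite /F; case: pickle_inv => [v|//]; case: ifP.
have AF : env xi n m @^-1` A = \bigcup_k F k.
  apply/seteqP; split=> w /=.
    move=> Aw; exists (pickle (env xi n m w)) => //.
    by rewrite /F pickleK_inv mem_set.
  move=> [k _]; rewrite /F; case: pickle_inv => [v|//]; case: ifP => [/set_mem Av ->|]//.
split; first by rewrite AF; exact: bigcup_measurable.
apply: (@le_trans _ _ (\sum_(k <oo) P (F k))%E).
  apply: measure_sigma_subadditive => //; last by rewrite AF.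
  by rewrite AF; exact: bigcup_measurable.
rewrite nneseries_esumT; last by move=> k; exact: measure_ge0.
rewrite [leLHS](_ : _ = \esum_(k in pickle @` A) P (F k)); last first.
  rewrite [RHS]esum_mkcond; apply: eq_esum => k _; case: ifPn => // /negP nk.
  rewrite /F; case e: (pickle_inv k) => [v|]; last by rewrite measure0.
  case: ifP => [/set_mem Av|]; last by rewrite measure0.
  case: nk; apply/mem_set; exists v => //.
  by have := pickle_invK (T := conf n m) k; rewrite e.
rewrite esum_image; last by move=> x y _ _; exact: (pcan_inj pickleK).
by apply: le_esum => v Av; rewrite /F pickleK_inv mem_set// PE.
Qed.

Lemma exp_summable (C c : R) : 0 <= C -> 0 < c ->
  (\sum_(n <oo) (C * expR (- c * n%:R))%:E < +oo)%E.
Proof.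
move=> C0 c0; have z1 : expR (- c) < 1 by rewrite expR_lt1 oppr_lt0.
apply: (@le_lt_trans _ _ (C / (1 - expR (- c)))%:E); last exact: ltry.
have g0 n : (0 <= (C * expR (- c * n%:R))%:E)%E by rewrite lee_fin mulr_ge0 ?expR_ge0.
apply: lime_le; first by apply: is_cvg_nneseries => n _ _; exact: g0.
apply: nearW => n; rewrite sumEFin lee_fin.
have -> : \sum_(0 <= i < n) C * expR (- c * i%:R) = series (geometric C (expR (- c))) n.
  by apply: eq_bigr => i _; rewrite /= expRM_natr.
rewrite geometric_seriesE ?lt_eqF//= ler_wpM2r ?invr_ge0 ?subr_ge0 ?(ltW z1)//.
rewrite mulrBr mulr1 lerBlDr lerDl mulr_ge0// exprn_ge0//; exact: expR_ge0.
Qed.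

(** Borel-Cantelli for each threshold 1 / (k + 1), then a countable intersection over [k]. *)
Lemma ae_cvg_of_exp_tails (X : nat -> T -> R) (l : R) :
  (forall del : R, 0 < del -> exists (C c : R) (N0 : nat), [/\ 0 <= C, 0 < c &
     forall N, (N0 <= N)%N -> measurable [set w | del < `|X N w - l|] /\
       (P [set w | (del < `|X N w - l|)%R] <= (C * expR (- c * N%:R))%:E)%E]) ->
  {ae P, forall w, X ^~ w @ \oo --> l}.
Proof.
move=> H.
have {}H k : {ae P, forall w, exists N1, forall N, (N1 <= N)%N -> `|X N w - l| <= k.+1%:R^-1}.
  have [|C [c [N0 [C0 c0 HN]]]] := H k.+1%:R^-1; first by rewrite invr_gt0.
  pose F j : set T := [set w | k.+1%:R^-1 < `|X (j + N0)%N w - l|].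
  have mF j : measurable (F j) by have [] := HN (j + N0)%N (leq_addl _ _).
  have F0 : P (lim_sup_set F) = 0%E.
    apply: lim_sup_set_cvg0 => //; apply: le_lt_trans (exp_summable C0 c0).
    apply: lee_nneseries => [j _ _|j _]; first exact: measure_ge0.
    have [_ +] := HN (j + N0)%N (leq_addl _ _); move=> /le_trans; apply.
    by rewrite lee_fin ler_wpM2l// ler_expR !mulNr lerN2 ler_pM2l// ler_nat leq_addr.
  exists (lim_sup_set F); split=> //.
    apply: bigcap_measurable => // i _; apply: bigcup_measurable => j _; exact: mF.
  move=> w /= nw i _; apply: contrapT => ne; apply: nw.
  exists (i + N0)%N => N iN; rewrite leNgt; apply/negP => FN.
  have N0N : (N0 <= N)%N := leq_trans (leq_addl i N0) iN.
  apply: ne; exists (N - N0)%N; first by rewrite /= -(leq_add2r N0) subnK.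
  by rewrite /F /= subnK.
apply: filterS (ae_foralln H) => w hw.
apply/cvgrPdist_le => e e0.
have [k ke] : exists k : nat, k.+1%:R^-1 <= e.
  exists (Num.truncn e^-1); rewrite -[leRHS]invrK lef_pV2 ?posrE ?invr_gt0//.
  have e10 : 0 <= e^-1 by rewrite invr_ge0 ltW.
  by have /andP[_ /ltW] := truncn_itv e10.
have [N1 h] := hw k; exists N1 => // N /= N1N; rewrite distrC.
exact: le_trans (h _ N1N) ke.
Qed.

End random_environment.

Theorem mainTheorem12 (d : measure_display) (T : measurableType d)
  (R : realType) (P : probability T R) (lambda beta : R)
  (xi : nat * nat -> T -> nat) :
  0 < lambda < 1 -> 0 < beta ->
  (forall y, site y -> measurable_fun setT (xi y)) ->
  iid_indep P xi ->
  (forall y, site y -> geometric_law P lambda (xi y)) ->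
  let ell := (1 + Num.sqrt (beta * lambda)) ^+ 2 / (1 - lambda) - 1 in
  let GN := fun (N : nat) (w : T) =>
    (last_passage xi N (Num.truncn (beta * N%:R)) w)%:R / N%:R : R in
  {ae P, forall w, (fun N => GN N w) @ \oo --> ell}
  /\
  (forall delta : R, 0 < delta ->
     exists C c : R, 0 < C /\ 0 < c /\
       forall N : nat, (1 <= N)%N -> (1 <= Num.truncn (beta * N%:R))%N ->
         (P [set w | (delta < `| GN N w - ell |)%R] <= (C * expR (- c * N%:R))%:E)%E).
Proof.
move=> lam01 beta0 mxi ixi gxi ell GN.
have law n m B := @env_law d T R P xi lambda n m B lam01 mxi ixi gxi.
have tails del : 0 < del -> exists C c : R, [/\ 0 < C, 0 < c &
    forall N : nat, (1 <= N)%N -> (1 <= Num.truncn (beta * N%:R))%N ->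
      measurable [set w | del < `|GN N w - ell|] /\
      (P [set w | (del < `|GN N w - ell|)%R] <= (C * expR (- c * N%:R))%:E)%E].
  move=> del0; have [C [c [C0 c0 H]]] := lpp_shape_tails lam01 beta0 del0.
  exists C, c; split=> // -[//|n] _; case em: (Num.truncn _) => [//|m] _.
  have [mA PA] := law n m [set y | del < `|(lpp (mat y) n m)%:R / n.+1%:R - ell|].
  have eA : [set w | del < `|GN n.+1 w - ell|] =
      env xi n m @^-1` [set y | del < `|(lpp (mat y) n m)%:R / n.+1%:R - ell|].
    apply/seteqP; split=> w /=; rewrite /GN em last_passageE;
      rewrite (@lpp_ext _ (mat (env xi n m w)))// => i j ni mj;
      by rewrite /mat ffunE /= !inordK.
  by rewrite eA; split=> //; apply: (le_trans PA); apply: H.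
split; last first.
  move=> del del0; have [C [c [C0 c0 H]]] := tails _ del0.
  by exists C, c; do 2!split=> //; move=> N N1 M1; have [] := H N N1 M1.
apply: ae_cvg_of_exp_tails => del del0; have [C [c [C0 c0 H]]] := tails _ del0.
(* Beyond 1 / beta the rectangle has at least one row, as [tails] demands. *)
exists C, c, (Num.truncn beta^-1).+1; split=> // [|N NN]; first exact: ltW.
apply: H; first exact: leq_trans NN.
have b0 : 0 < beta^-1 by rewrite invr_gt0.
rewrite truncn_gt0; have /andP[_ h] := truncn_itv (ltW b0).
by rewrite -[leLHS](mulfV (lt0r_neq0 beta0)) ler_pM2l// (le_trans (ltW h))// ler_nat.
Qed.
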